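(* Let $m,n\ge 1$ and $1\le k\le \min(m,n)$ be integers and consider the random bipartite graph process $G(t)\subseteq K_{m,n}$ with nonnegative edge rates $a_{ij}$, where $[\mathcal{E}_{m,n}\setminus B]>0$ for every $B\in\mathrm{Tabloid}_k$. Then $$\mathrm{E}(T_{mn}(k))=\sum_{B\in \mathrm{Tabloid}_k}\frac{S_{m,n,k}(B)}{[\mathcal{E}_{m,n}\setminus B]},$$ where for $B\in\mathrm{Tabloid}_k$ with $I$ inner corners and mid rectangle parameters $(m_i,n_i,k_i)_{1\le i\le I}$, $$S_{m,n,k}(B)=(-1)^{I+1}\prod_{i=1}^I\binom{m_i-1}{k_i-1}\binom{n_i-1}{k_i-1}.$$
   Context: Let $\mathcal{E}_{m,n}=\{e_{ij}:1\le i\le m,\ 1\le j\le n\}$ be the edge set of the complete bipartite graph $K_{m,n}$, identified with the set of entries of an $m\times n$ matrix. Each $e_{ij}$ is given a rate $a_{ij}\ge0$ and appears at a random time $t_{ij}$; the times are independent and exponentially distributed with $\Pr(t_{ij}>t)=\exp(-a_{ij}t)$ (an edge of rate $0$ never appears). $G(t)$ is the graph whose edges are those with $t_{ij}\le t$. A $k$-assignment is a set of $k$ pairwise disjoint edges (no two in the same row or the same column). $T_{mn}(k)$ is the first time $t$ at which $G(t)$ contains a $k$-assignment. For $A\subseteq\mathcal{E}_{m,n}$, $[A]=\sum_{e_{ij}\in A}a_{ij}$. A proper subset $B\subsetneq\mathcal{E}_{m,n}$ (possibly empty) is tabloidal if, after some permutation of rows and some permutation of columns, it becomes a tableau shape (Young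 diagram) $\{(a,b): 1\le a\le m,\ 1\le b\le\lambda_a\}$ for some integers $n\ge\lambda_1\ge\cdots\ge\lambda_m\ge0$; the sequence $\lambda$ is determined by $B$. Corners are recorded as lattice points $(p,q)$, where $p$ counts rows from the top and $q$ counts columns from the left. An inner corner is a pair $(p,q)$ with $0\le p\le m-1$, $0\le q\le n-1$ such that cell $(p+1,q+1)$ is not in the shape, and [$p=0$ or cell $(p,q+1)$ is in the shape], and [$q=0$ or cell $(p+1,q)$ is in the shape]. An outer corner is a pair $(p,q)$ with $1\le p\le m$, $1\le q\le n$ such that cell $(p,q)$ is in the shape, and neither $(p+1,q)$ nor $(p,q+1)$ is a cell of the shape. $\mathrm{Tabloid}_k$ is the set of all tabloidal $B$ such that every inner corner $(p,q)$ of its shape satisfies $p+q<k$ and every outer corner $(p,q)$ satisfies $p+q\ge k$. List the inner corners of the shape of $B$ as $(p_1,q_1),\dots,(p_I,q_I)$ with $p_1>p_2>\cdots>p_I$ and $q_1<q_2<\cdots<q_I$ (so $I\ge1$), and put $p_0=m$, $q_{I+1}=n$. The $i$th mid rectangle consists of rows $p_i+1,\dots,p_{i-1}$ and columns $q_i+1,\dots,q_{i+1}$; its parameters are $m_i=p_{i-1}-p_i$, $n_i=q_{i+1}-q_i$ and $k_i=k-p_i-q_i$. *)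

(* Defs.v *)
From HB Require Import structures.
From mathcomp Require Import all_boot all_order all_algebra all_fingroup.
From mathcomp Require Import all_classical all_reals all_analysis.
From mathcomp Require Import measurable_realfun.

Set Implicit Arguments.
Unset Strict Implicit.
Unset Printing Implicit Defensive.

Import Order.TTheory GRing.Theory Num.Theory.

Local Open Scope classical_set_scope.
Local Open Scope ring_scope.

(* The edge e_(i+1,j+1) of K_(m,n) is the pair (i, j), indices starting at 0. *)
Definition edge (m n : nat) : finType := ('I_m * 'I_n)%type.

Section Probability.
Context {R : realType} {d : measure_display} {Omega : measurableType d}
  (P : probability Omega R).

Definition mutually_independent (I : finType) d' (E : measurableType d')
    (X : I -> {RV P >-> E}) : Prop :=
  forall (J : {set I}) (A : I -> set E), (forall i, measurable (A i)) ->
    P (\bigcap_(i in [set` J]) (X i @^-1` A i)) =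
    (\prod_(i in J) P (X i @^-1` A i))%E.

(* The times are extended reals: for r = 0 the condition says that X = +oo
   almost surely. *)
Definition exponential_time (r : R) (X : {RV P >-> \bar R}) : Prop :=
  forall s : R, 0 <= s ->
    P [set w | (s%:E < X w)%E] = (expR (- (r * s)))%:E.

End Probability.

Section Process.
Context {R : realType} {Omega : Type} {m n : nat}.
Implicit Types (t : edge m n -> Omega -> \bar R) (w : Omega).

Definition is_assignment (k : nat) (A : {set edge m n}) : bool :=
  (#|A| == k) &&
  [forall e in A, forall f in A, (e != f) ==> (e.1 != f.1) && (e.2 != f.2)].

Definition graph t w (s : R) : {set edge m n} :=
  [set e | (t e w <= s%:E)%E]%SET.

(* Equal to +oo if no k-assignment ever appears.  The infimum is attained when
   finite, since graph t w s is right-continuous in s. *)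
Definition first_time t (k : nat) (w : Omega) : \bar R :=
  ereal_inf [set s%:E | s in [set s : R | 0 <= s /\
    exists A : {set edge m n}, is_assignment k A /\ A \subset graph t w s]].

Definition rate (a : edge m n -> R) (A : {set edge m n}) : R :=
  \sum_(e in A) a e.

End Process.

Local Open Scope nat_scope.

Section Shapes.
Context {m n : nat}.
Implicit Types (lam : {ffun 'I_m -> 'I_n.+1}) (B : {set edge m n}).

Definition is_partition lam : bool :=
  [forall i : 'I_m, forall j : 'I_m, (i <= j) ==> (lam j <= lam i)].

Definition diagram lam : {set edge m n} :=
  [set e : edge m n | e.2 < lam e.1]%SET.

Definition has_shape B lam : bool :=
  is_partition lam &&
  [exists s : 'S_m, exists u : 'S_n,
     [set (s e.1, u e.2) | e in B]%SET == diagram lam].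

Definition tabloidal B : bool :=
  (B != [set: edge m n]%SET) && [exists lam, has_shape B lam].

(* The unique lam such that has_shape B lam; a dummy value if there is none. *)
Definition tab_shape B : {ffun 'I_m -> 'I_n.+1} :=
  odflt [ffun=> ord0] [pick lam | has_shape B lam].

(* Here a and b start at 1; cells outside the m x n board are never present. *)
Definition cell lam (a b : nat) : bool :=
  [exists e in diagram lam, (e.1.+1 == a) && (e.2.+1 == b)].

Definition inner_corner lam (c : nat * nat) : bool :=
  let: (p, q) := c in
  [&& p < m, q < n, ~~ cell lam p.+1 q.+1,
      (p == 0) || cell lam p q.+1 & (q == 0) || cell lam p.+1 q].

Definition outer_corner lam (c : nat * nat) : bool :=
  let: (p, q) := c in
  [&& 1 <= p <= m, 1 <= q <= n, cell lam p q,
      ~~ cell lam p.+1 q & ~~ cell lam p q.+1].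

(* In order of decreasing p, hence of increasing q. *)
Definition inner_corners lam : seq (nat * nat) :=
  [seq c <- [seq (p, q) | p <- rev (iota 0 m), q <- iota 0 n]
     | inner_corner lam c].

Definition outer_corners lam : seq (nat * nat) :=
  [seq c <- [seq (p, q) | p <- iota 1 m, q <- iota 1 n] | outer_corner lam c].

Definition Tabloid (k : nat) : {set {set edge m n}} :=
  [set B | [&& tabloidal B,
     all (fun c => c.1 + c.2 < k) (inner_corners (tab_shape B)) &
     all (fun c => k <= c.1 + c.2) (outer_corners (tab_shape B))]]%SET.

Definition num_inner lam : nat := size (inner_corners lam).

(* p_i for 0 <= i <= I, with p_0 = m. *)
Definition corner_p lam (i : nat) : nat :=
  nth 0 (m :: [seq c.1 | c <- inner_corners lam]) i.

(* q_i for 1 <= i <= I + 1, with q_(I+1) = n. *)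
Definition corner_q lam (i : nat) : nat :=
  nth n [seq c.2 | c <- inner_corners lam] i.-1.

(* For lam = tab_shape B with B in Tabloid k and 1 <= i <= I, the subtractions
   below are not truncated and the three parameters are positive. *)
Definition mid_m lam (i : nat) : nat := corner_p lam i.-1 - corner_p lam i.
Definition mid_n lam (i : nat) : nat := corner_q lam i.+1 - corner_q lam i.
Definition mid_k (k : nat) lam (i : nat) : nat :=
  k - corner_p lam i - corner_q lam i.

Definition S_coef (R : realType) (k : nat) B : R :=
  let lam := tab_shape B in
  ((-1) ^+ (num_inner lam).+1 *
   \prod_(1 <= i < (num_inner lam).+1)
     ('C((mid_m lam i).-1, (mid_k k lam i).-1)%:R *
      'C((mid_n lam i).-1, (mid_k k lam i).-1)%:R))%R.

End Shapes.

Arguments Tabloid : clear implicits.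

(* Main.v *)
Require Import Defs.
From HB Require Import structures.
From mathcomp Require Import all_boot all_order all_algebra all_fingroup.
From mathcomp Require Import reals zify ring.

(** The expectation is the integral over s >= 0 of the probability that G(s)
    has no k-assignment, and everything rests on a deterministic identity,
    [sum_S_coef]: for every graph G, the numbers S(B), summed over the B in
    Tabloid_k that contain G, add up to 1 if G has no k-assignment and to 0 if
    it has one.  Given this, the probability at time s is the sum of
    S(B) Pr(G(s) is inside B), which by independence is the sum of
    S(B) exp(- [E \ B] s), and integrating term by term gives the theorem.

    To prove the identity, let H be the complement of G.  By König's theorem
    ([konig]), G has no k-assignment exactly when H contains a rectangle X x Y
    with |X| + |Y| >= N, where N = m + n - k + 1; call such a rectangle large.
    The maximal rectangles in the complement of a tabloidal set B form a chain
    X_1 < ... < X_I, Y_1 > ... > Y_I (strict inclusions), one for each inner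
    corner: (p_i, q_i) = (m - |X_i|, n - |Y_i|).  The condition on inner corners
    says that they are all large, and when the condition on outer corners fails
    some binomial coefficient of S(B) vanishes.  So the sum of the S(B) is a
    signed sum over the nonempty chains of large rectangles in H, with weights
    the products of C(|X_i| - |X_(i-1)| - 1, r_i) C(|Y_i| - |Y_(i+1)| - 1, r_i),
    where r_i = |X_i| + |Y_i| - N.

    Each of these binomial coefficients is, up to sign, the sum of the Möbius
    function of a Boolean lattice over those sets of an interval that still
    give a large rectangle ([sum_sign_large]).  Order pairs (X, Y) by letting X
    grow and Y shrink, and let f(X, Y) be 1 if some large rectangle of H lies
    above (X, Y) and 0 otherwise.  Evaluating the sum over chains from the last
    rectangle backwards, the contribution of all the chains that start at a
    given rectangle is, up to sign, the Möbius inverse of f in its column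
    argument ([sum_chains_above]).  What remains is a Möbius inversion formula
    in which only large rectangles occur ([sum_col_moebius]).  It holds because
    the Möbius inverse of f in both arguments vanishes at every rectangle of H
    that is not large ([row_col_moebius_eq0]): above such a rectangle choose a
    rectangle A x C of H for which |A| + |C| is largest; since |X| + |Y| is
    modular, replacing (X, Y) by its join with (A, C) does not change f
    ([has_large_join]), so f does not notice the insertion or deletion of some
    element, and the terms of its alternating sum cancel in pairs. *)

Set Implicit Arguments.
Unset Strict Implicit.
Unset Printing Implicit Defensive.

Import Order.TTheory GRing.Theory Num.Theory.

Local Open Scope ring_scope.

(** * Alternating sums over intervals of sets *)

Section AlternatingSums.
Variables (R : comNzRingType) (T : finType).
Implicit Types A B S W : {set T}.

(** Inserting and deleting x pairs off the terms. *)
Lemma sum_toggle0 (x : T) (P : pred {set T}) (F : {set T} -> R) :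
    (forall S, x \notin S -> P (x |: S) = P S) ->
    (forall S, x \notin S -> P S -> F (x |: S) = - F S) ->
  \sum_(S | P S) F S = 0.
Proof.
move=> hP hF; rewrite (bigID (fun S => x \in S)) /=.
rewrite (reindex_onto (fun S => x |: S) (fun S => S :\ x)) /=; last first.
  by move=> S /andP[_ xS]; rewrite setD1K.
rewrite (eq_bigl (fun S => P S && (x \notin S))); last first.
  move=> S; rewrite setU11 andbT; case xS: (x \in S) => /=.
    rewrite andbF; apply/negP => /andP[_ /eqP eS].
    by move: xS; rewrite -eS !inE eqxx.
  by rewrite setU1K ?xS // eqxx !andbT hP ?xS.
rewrite -big_split big1 // => S /andP[PS xS].
by rewrite /= hF // addNr.
Qed.

(** Möbius inversion in the lattice of subsets: the signs are the values of its
    Möbius function. *)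
Lemma sum_sign_interval A B :
  \sum_(S : {set T} | (A \subset S) && (S \subset B)) (-1) ^+ (#|B| + #|S|) =
    (A == B)%:R :> R.
Proof.
case: eqVneq => [->|neq] /=.
  rewrite (big_pred1 B) => [|S]; last by rewrite -eqEsubset eq_sym.
  by rewrite addnn -signr_odd odd_double.
have [sAB|nsAB] := boolP (A \subset B); last first.
  rewrite big_pred0 // => S; apply/negP => /andP[h1 h2].
  by rewrite (subset_trans h1 h2) in nsAB.
have /properP[_ [x xB xA]] : A \proper B by rewrite properEneq neq.
apply: (sum_toggle0 (x := x)) => S xS.
  congr (_ && _); last by rewrite subUset sub1set xB.
  apply/idP/idP => [/subsetP h|h]; last by rewrite (subset_trans h) ?subsetUr.
  apply/subsetP => y yA; move: (h y yA); rewrite !inE => /orP[/eqP e|//].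
  by rewrite -e yA in xA.
by move=> _; rewrite cardsU1 xS addnCA exprS mulN1r.
Qed.

Lemma sum_sign_small W r : W != set0 ->
  \sum_(S : {set T} | (S \subset W) && (#|S| <= r)%N) (-1) ^+ #|S| =
    (-1) ^+ r * 'C(#|W|.-1, r)%:R :> R.
Proof.
rewrite -card_gt0 => W0; elim: r => [|r IHr].
  rewrite (big_pred1 set0) => [|S]; first by rewrite cards0 bin0 mulr1.
  rewrite /= leqn0 cards_eq0; case: eqVneq => [->|]; last by rewrite andbF.
  by rewrite sub0set.
rewrite (bigID (fun S => #|S| <= r)%N) /=.
rewrite (eq_bigl (fun S => (S \subset W) && (#|S| <= r)%N)); last first.
  move=> S; rewrite -andbA; congr (_ && _).
  by apply: andb_idl => h; rewrite leqW.
rewrite IHr (eq_bigl (fun S => S \in [set A : {set T} | A \subset W & #|A| == r.+1]));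
  last first.
  by move=> S; rewrite inE -andbA -ltnNge eqn_leq.
rewrite (eq_bigr (fun _ => (-1) ^+ r.+1)) => [|S]; last first.
  by rewrite inE => /andP[_ /eqP ->].
rewrite sumr_const cards_draws -(prednK W0) binS /= !exprS mulN1r.
by rewrite mulrnDr mulNrn mulNrn !mulr_natr mulNrn addrCA addrN addr0.
Qed.

(** The source of the binomial coefficients of S(B).  In terms of the
    complements in B this is the identity expressing a partial alternating sum
    of a row of the triangle of Pascal as a single entry of the row above. *)
Lemma sum_sign_large A B t : A \proper B -> (t <= #|B|)%N ->
  \sum_(S : {set T} | [&& A \subset S, S \subset B & (t <= #|S|)%N])
      (-1) ^+ (#|B| + #|S|) =
    (-1) ^+ (#|B| - t) * 'C((#|B| - #|A|).-1, #|B| - t)%:R :> R.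
Proof.
move=> pAB tB; have sAB := proper_sub pAB.
have cD : #|B :\: A| = (#|B| - #|A|)%N by rewrite cardsD (setIidPr sAB).
rewrite -cD -sum_sign_small; last first.
  by rewrite -card_gt0 cD subn_gt0 proper_card.
rewrite (reindex_onto (fun S => B :\: S) (fun S => B :\: S)) /=; last first.
  by move=> S /and3P[_ sSB _]; rewrite setDDr setDv set0U; apply/setIidPr.
have eS S : S \subset B -> #|B :\: S| = (#|B| - #|S|)%N.
  by move=> h; rewrite cardsD (setIidPr h).
apply: eq_big => [S|S /andP[_ /eqP]].
  rewrite subsetDl /= subsetD sAB /= setDDr setDv set0U.
  rewrite subsetD [S \subset B](sameP setIidPr eqP) disjoint_sym.
  case: eqP => [/setIidPr sSB|]; last by rewrite !andbF.
  rewrite eS // !andbT; congr (_ && _).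
  by have := subset_leq_card sSB; lia.
rewrite setDDr setDv set0U => /setIidPr sSB; rewrite eS //.
have := subset_leq_card sSB => h.
have -> : (#|B| + (#|B| - #|S|) = (#|B| - #|S|).*2 + #|S|)%N by lia.
by rewrite exprD -[_ ^+ _.*2]signr_odd odd_double mul1r.
Qed.

End AlternatingSums.

(** * Möbius inversion over large rectangles *)

Section Rectangles.
Variables (I J : finType) (H : {set I * J}) (N : nat).
Local Notation rectangle := ({set I} * {set J})%type.
Implicit Types (z w : rectangle) (X : {set I}) (Y : {set J}).

Definition rect z : bool := setX z.1 z.2 \subset H.
Definition semiperimeter z : nat := #|z.1| + #|z.2|.
Definition above z w : bool := (z.1 \subset w.1) && (w.2 \subset z.2).
Definition has_large z : bool :=
  [exists w, [&& rect w, (N <= semiperimeter w)%N & above z w]].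

Lemma rectP z : reflect {in z.1 & z.2, forall i j, (i, j) \in H} (rect z).
Proof.
apply: (iffP subsetP) => [h i j iz jz|h [i j]]; first by apply: h; rewrite inE iz jz.
by rewrite inE => /andP[]; exact: h.
Qed.

Lemma above_refl z : above z z.
Proof. by rewrite /above !subxx. Qed.

Lemma above_trans z1 z2 z3 : above z1 z2 -> above z2 z3 -> above z1 z3.
Proof.
move=> /andP[a b] /andP[c d].
by rewrite /above (subset_trans a c) (subset_trans d b).
Qed.

Lemma has_large_above z w : above z w -> has_large w -> has_large z.
Proof.
move=> zw /existsP[v /and3P[rv lv wv]]; apply/existsP; exists v.
by rewrite rv lv (above_trans zw wv).
Qed.

Lemma rectS X X' Y Y' : X' \subset X -> Y' \subset Y ->
  rect (X, Y) -> rect (X', Y').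
Proof.
move=> /subsetP sX /subsetP sY /rectP h; apply/rectP => i j iX jY.
by apply: h; [exact: sX | exact: sY].
Qed.

(** Let w be a rectangle of largest semiperimeter above z.  If x is a large
    rectangle above v, the semiperimeters of the join and of the meet of x and w
    add up to those of x and w, and the meet, a rectangle above z, has at most
    that of w.  So the join has at least that of x: it is a large rectangle
    above the join of v and w. *)
Lemma has_large_join z w v :
    rect w -> above z w ->
    (forall w', rect w' -> above z w' -> (semiperimeter w' <= semiperimeter w)%N) ->
    above z v ->
  has_large (v.1 :|: w.1, v.2 :&: w.2) = has_large v.
Proof.
case: w v => [A C] [X Y] /= rw zw wmax zv; apply/idP/idP.
  by apply: has_large_above; rewrite /above /= subsetUl subsetIl.
case/existsP => [[X3 Y3] /and3P[r3 l3 /andP[/= s3 t3]]].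
apply/existsP; exists (X3 :|: A, Y3 :&: C); apply/and3P; split.
- apply/rectP => i j; rewrite !inE /= => /orP[] iX /andP[jY jC].
    by move/rectP: r3; apply.
  by move/rectP: rw; apply.
- apply: leq_trans l3 _.
  have := wmax (X3 :&: A, Y3 :|: C); rewrite /semiperimeter /=.
  have -> : rect (X3 :&: A, Y3 :|: C).
    apply/rectP => i j; rewrite !inE /= => /andP[iX iA] /orP[] jY.
      by move/rectP: r3; apply.
    by move/rectP: rw; apply.
  have -> : above z (X3 :&: A, Y3 :|: C).
    move: zw zv; rewrite /above /= => /andP[zA zC] /andP[zX zY].
    rewrite subsetI subUset zA zC (subset_trans zX s3).
    by rewrite (subset_trans t3 zY).
  move=> /(_ isT isT).
  have := cardsUI X3 A; have := cardsUI Y3 C.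
  by rewrite (_ : X3 :|: A = A :|: X3) 1?setUC //; lia.
- by rewrite /above /= setSU ?setSI.
Qed.

Section Sums.
Variable R : comNzRingType.

(** The Möbius inverse of [has_large] in its column argument. *)
Definition col_moebius z : R :=
  \sum_(Y : {set J} | Y \subset z.2)
     (-1) ^+ (#|z.2| + #|Y|) * (has_large (z.1, Y))%:R.

(** The Möbius inverse of [has_large] in both arguments, the row argument being
    confined to the sets that form a rectangle of H with Y. *)
Definition row_col_moebius X Y : R :=
  \sum_(X2 : {set I} | (X \subset X2) && rect (X2, Y))
     (-1) ^+ (#|X2| + #|X|) * col_moebius (X2, Y).

(** By [has_large_join], [has_large] above (X, Y) is unchanged when the elements
    of A are added to the rows and those outside C are removed from the columns,
    where A x C is of largest semiperimeter.  If A x C is X x Y itself, no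
    large rectangle lies above (X, Y) and all terms are 0.  Otherwise some
    element of Y outside C, or of A outside X, can be toggled freely. *)
Lemma row_col_moebius_eq0 X Y :
  rect (X, Y) -> (semiperimeter (X, Y) < N)%N -> row_col_moebius X Y = 0.
Proof.
move=> rXY small.
pose P w := rect w && above (X, Y) w.
have P0 : P (X, Y) by rewrite /P rXY above_refl.
case: (arg_maxnP semiperimeter P0) => -[A C] /andP[rAC aAC] maxAC.
have join v : above (X, Y) v -> has_large (v.1 :|: A, v.2 :&: C) = has_large v.
  move=> av; apply: (has_large_join rAC aAC _ av) => w' rw' aw'.
  by apply: maxAC; rewrite /P rw' aw'.
have /andP[/= sXA sCY] := aAC.
have [eC|nC] := eqVneq C Y; last first.
  have /properP[_ [y yY yC]] : C \proper Y by rewrite properEneq nC.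
  rewrite /row_col_moebius big1 // => X2 /andP[sX _].
  suff -> : col_moebius (X2, Y) = 0 by rewrite mulr0.
  apply: (sum_toggle0 (x := y)) => /= S yS.
    by rewrite subUset sub1set yY.
  move=> sSY; rewrite cardsU1 yS addnCA exprS mulN1r mulNr; congr (- (_ * _%:R)).
  have h1 : above (X, Y) (X2, S) by rewrite /above /= sX.
  have h2 : above (X, Y) (X2, y |: S).
    by rewrite /above /= sX subUset sub1set yY.
  rewrite -[in LHS]join // -[in RHS]join //=; congr (nat_of_bool (has_large (_, _))).
  by apply/setP => x; rewrite !inE; case: eqP => [->|//]; rewrite (negPf yC) !andbF.
have [eA|nA] := eqVneq X A.
  rewrite /row_col_moebius big1 // => X2 /andP[sX r2].
  rewrite /col_moebius big1 ?mulr0 // => S /= sS.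
  suff -> : has_large (X2, S) = false by rewrite mulr0.
  rewrite -join /= ?eC -?eA; last by rewrite /above /= sX.
  apply/existsP => -[w /and3P[rw lw aw]].
  have := maxAC w; rewrite /P rw -eA eC /=.
  rewrite (above_trans _ aw); last first.
    by rewrite /above /= subsetUr subsetIr.
  by move=> /(_ isT); rewrite leqNgt (leq_trans small).
(* Since C = Y, rows in A may be added to a rectangle of H on the columns Y, so
   that the range of summation is stable under toggling too. *)
have /properP[_ [x xA xX]] : X \proper A by rewrite properEneq nA.
rewrite /row_col_moebius (sum_toggle0 (x := x)) // => S xS.
  congr (_ && _).
    apply/idP/idP => [/subsetP h|h]; last by rewrite (subset_trans h) ?subsetUr.
    apply/subsetP => y yX; move: (h y yX); rewrite !inE => /orP[/eqP e|//].
    by rewrite -e yX in xX.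
  apply/idP/idP => [|/rectP h]; first by apply: rectS => //; exact: subsetUr.
  apply/rectP => i j; rewrite !inE /= => /orP[/eqP ->|iS] jY; last exact: h.
  by move/rectP: rAC; apply; rewrite //= eC.
move=> /andP[sXS _]; rewrite cardsU1 xS exprS mulN1r mulNr; congr (- (_ * _)).
rewrite /col_moebius; apply: eq_bigr => /= Y1 sY1; congr (_ * _%:R).
rewrite -[in LHS]join ?/above /= ?(subset_trans sXS) ?subsetUr //.
rewrite -[in RHS]join ?/above /= ?sXS //.
congr (nat_of_bool (has_large (_, _))).
by apply/setP => y; rewrite !inE; case: eqP => [->|//]; rewrite xA !orbT.
Qed.

(** Up to sign, the binomial coefficient that the rows of z contribute to S(B)
    when X is the row set of the preceding rectangle: see [row_coefE]. *)
Definition row_coef X z : R :=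
  \sum_(X' : {set I} | [&& X \subset X', X' \subset z.1 & (N <= semiperimeter (X', z.2))%N])
     (-1) ^+ (#|z.1| + #|X'|).

(** Unfolding [row_coef] turns the left-hand side into the sum of the double
    Möbius inverse over the large rectangles (X', Y2) above (X, Y).  By
    [row_col_moebius_eq0] the other rectangles may be included, and the
    unrestricted sum collapses by Möbius inversion in rows and then in
    columns. *)
Lemma sum_col_moebius X Y : rect (X, Y) ->
  \sum_(z | [&& rect z, (N <= semiperimeter z)%N & above (X, Y) z])
     row_coef X z * col_moebius z = (has_large (X, Y))%:R.
Proof.
move=> rXY.
transitivity (\sum_(Y2 : {set J} | Y2 \subset Y)
   \sum_(X2 : {set I} | [&& rect (X2, Y2), (N <= semiperimeter (X2, Y2))%N & X \subset X2])
     row_coef X (X2, Y2) * col_moebius (X2, Y2)).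
  rewrite (exchange_big_dep xpredT) //= pair_big_dep /=.
  apply: eq_big => [[X2 Y2]|[X2 Y2] _] //=.
  by rewrite /above /=; case: (Y2 \subset Y); rewrite ?andbT ?andbF.
transitivity (\sum_(Y2 : {set J} | Y2 \subset Y) col_moebius (X, Y2)); last first.
  rewrite /col_moebius /= (exchange_big_dep (fun Y1 => Y1 \subset Y)) /=; last first.
    by move=> Y2 Y1 h1 h2; exact: subset_trans h1.
  rewrite (bigD1 Y) //= [X in _ + X]big1 ?addr0 => [|Y1 /andP[sY nY]].
    rewrite (big_pred1 Y) => [|Y2]; last by rewrite /= -eqEsubset eq_sym.
    by rewrite addnn -signr_odd odd_double mul1r.
  rewrite -mulr_suml.
  have := sum_sign_interval R Y1 Y; rewrite (negPf nY) => e.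
  rewrite [X in X * _](_ : _ = 0) ?mul0r //.
  apply: etrans (etrans (congr1 (fun x => (-1) ^+ (#|Y| + #|Y1|) * x) e) (mulr0 _)).
  rewrite mulr_sumr; apply: eq_big => [Y2|Y2 _]; first by rewrite andbC.
  rewrite -exprD -[LHS]signr_odd -[RHS]signr_odd; congr (_ ^+ (nat_of_bool _)); lia.
apply: eq_bigr => Y2 sY2.
transitivity (\sum_(X' : {set I} | (X \subset X') && (N <= semiperimeter (X', Y2))%N)
   row_col_moebius X' Y2).
  rewrite /row_coef /=; under eq_bigr do rewrite mulr_suml.
  rewrite (exchange_big_dep (fun X' : {set I} =>
    (X \subset X') && (N <= semiperimeter (X', Y2))%N)) /=;
    last by move=> X2 X' _ /and3P[-> _ ->].
  apply: eq_bigr => X' /andP[sX' lX']; rewrite /row_col_moebius; apply: eq_bigl => X2.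
  rewrite sX' lX' /= andbT; apply/idP/idP.
    by case/andP => /and3P[-> _ _] ->.
  case/andP => sX2 ->; rewrite sX2 (subset_trans sX' sX2) /= !andbT.
  by apply: leq_trans lX' _; rewrite /semiperimeter /= leq_add2r subset_leq_card.
transitivity (\sum_(X' : {set I} | X \subset X') row_col_moebius X' Y2).
  rewrite [RHS](bigID (fun X' : {set I} => (N <= semiperimeter (X', Y2))%N)) /=.
  rewrite [X in _ = _ + X]big1 ?addr0 // => X' /andP[_ lX'].
  have [r'|/negP nr'] := boolP (rect (X', Y2)).
    by apply: row_col_moebius_eq0; rewrite // ltnNge.
  rewrite /row_col_moebius big_pred0 // => X2; apply/negP => /andP[sX r2]; apply: nr'.
  by apply: rectS r2.
rewrite /row_col_moebius.
rewrite (exchange_big_dep (fun X2 : {set I} => (X \subset X2) && rect (X2, Y2))) /=;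
  last by move=> X' X2 h1 /andP[h2 ->]; rewrite (subset_trans h1 h2).
under eq_bigr => X2 h2.
  rewrite -mulr_suml (eq_bigl (fun X' : {set I} => (X \subset X') && (X' \subset X2))).
    rewrite sum_sign_interval; over.
  by case/andP: h2 => _ r2 X'; rewrite r2 andbT.
have rX : (X \subset X) && rect (X, Y2) by rewrite subxx (rectS _ sY2 rXY).
rewrite (bigD1 X) //= eqxx mul1r big1 ?addr0 // => X2 /andP[_ n2].
by rewrite eq_sym (negPf n2) mul0r.
Qed.

End Sums.
End Rectangles.

(** * Signed sums over chains of large rectangles *)

Section Chains.
Variables (T : finType) (e : rel T).

(** The e-paths of length at most f starting in A, the empty one included: with
    an explicit list, sums over chains satisfy a recursion on the first
    element. *)
Fixpoint chains (f : nat) (A : pred T) : seq (seq T) :=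
  [::] :: if f is f'.+1
          then [seq x :: c | x <- enum A, c <- chains f' (e x)] else [::].

Lemma mem_chains f A c :
  (c \in chains f A) =
    (size c <= f)%N && (if c is x :: c' then A x && path e x c' else true).
Proof.
elim: f A c => [|f IHf] A [|x c] //=.
rewrite inE /= ltnS; apply/allpairsPdep/idP => [[y [b [yA bc [-> ->]]]]|].
  by rewrite mem_enum in yA; move: bc; rewrite IHf; case: b => [|z b] /=;
    rewrite [A _]yA //= => /andP[-> ->].
case/and3P => sc Ax pc; exists x, c; split=> //; first by rewrite mem_enum.
by rewrite IHf sc; case: c pc {sc}.
Qed.

Lemma uniq_chains f A : uniq (chains f A).
Proof.
elim: f A => [|f IHf] A //=; apply/andP; split.
  by apply/negP => /allpairsPdep[x [c []]].
apply: allpairs_uniq_dep; [exact: enum_uniq | by move=> x _; exact: IHf |].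
by move=> [x b] [y c] /= _ _ [-> ->].
Qed.

Lemma big_chainsS (V : nmodType) f A (F : seq T -> V) :
  \sum_(c <- chains f.+1 A) F c =
    F [::] + \sum_(x | A x) \sum_(c <- chains f (e x)) F (x :: c).
Proof. by rewrite big_cons big_allpairs_dep big_enum. Qed.

End Chains.

Section ChainSum.
Variables (I J : finType) (H : {set I * J}) (N : nat) (R : comNzRingType).
Local Notation rectangle := ({set I} * {set J})%type.
Implicit Types (z : rectangle) (c : seq rectangle).

(** From one maximal rectangle to the next, read from the lowest inner corner
    upwards, the row set grows and the column set shrinks. *)
Definition shrinks z1 z2 : bool := (z1.1 \proper z2.1) && (z2.2 \proper z1.2).
Definition large_rect z : bool := rect H z && (N <= semiperimeter z)%N.
Definition chain_step z1 z2 : bool := large_rect z2 && shrinks z1 z2.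

Definition next_width c : nat := #|(head (set0, set0) c).2|.

(** Up to sign S(B), where c is the chain of maximal rectangles in
    the complement of B and x is the number of rows of the rectangle before c, 0
    at the start.  The factors of the mid rectangle of z are read off from the
    rows of the previous rectangle and the columns of the next one. *)
Fixpoint chain_coef (x : nat) c : R :=
  if c is z :: c' then
    'C((#|z.1| - x).-1, semiperimeter z - N)%:R *
    'C((#|z.2| - next_width c').-1, semiperimeter z - N)%:R * chain_coef #|z.1| c'
  else 1.

Hypotheses (ltIN : (#|I| < N)%N) (ltJN : (#|J| < N)%N).

Lemma row_coefE (X : {set I}) z : X \proper z.1 -> (N <= semiperimeter z)%N ->
  row_coef N R X z =
    (-1) ^+ (semiperimeter z - N) * 'C((#|z.1| - #|X|).-1, semiperimeter z - N)%:R.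
Proof.
move=> pX lz; have z2J : (#|z.2| <= #|J|)%N := max_card _.
rewrite /row_coef; have -> : (semiperimeter z - N = #|z.1| - (N - #|z.2|))%N.
  by rewrite /semiperimeter; lia.
rewrite -sum_sign_large //; last by move: lz; rewrite /semiperimeter; lia.
by apply: eq_bigl => X'; rewrite leq_subLR addnC.
Qed.

(** Split the Möbius sum defining the left-hand side according to whether
    (z.1, Y') is large.  If it is, [has_large] is 1 there, and these terms give
    the first binomial coefficient.  If it is not, rewrite [has_large] by
    [sum_col_moebius]; collecting the coefficient of each w leaves a Möbius sum
    over the sets Y' containing w.2 that are too small to be large, which is the
    opposite of the sum over those that are not. *)
Lemma col_moebius_step z : large_rect z ->
  (-1) ^+ (semiperimeter z - N) * col_moebius H N R z =
    'C(#|z.2|.-1, semiperimeter z - N)%:R -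
    \sum_(w | chain_step z w)
       'C((#|z.2| - #|w.2|).-1, semiperimeter z - N)%:R *
       'C((#|w.1| - #|z.1|).-1, semiperimeter w - N)%:R *
       ((-1) ^+ (semiperimeter w - N) * col_moebius H N R w).
Proof.
case: z => X Y /andP[rz lz]; rewrite /col_moebius /=.
set r := (semiperimeter _ - N)%N.
have XI : (#|X| <= #|I|)%N := max_card _.
have rE : r = (#|Y| - (N - #|X|))%N by rewrite /r /semiperimeter /=; lia.
have tY : (N - #|X| <= #|Y|)%N by move: lz; rewrite /semiperimeter /=; lia.
have sqr s (x : R) : (-1) ^+ s * ((-1) ^+ s * x) = x.
  by rewrite mulrA -exprD addnn -signr_odd odd_double mul1r.
have Y0 : set0 \proper Y by rewrite proper0 -card_gt0; move: tY; lia.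
rewrite (bigID (fun Y' : {set J} => (N <= semiperimeter (X, Y'))%N)) /= mulrDr.
congr (_ + _).
  rewrite -[RHS](sqr r) rE; have := sum_sign_large R Y0 tY.
  rewrite cards0 subn0 => <-; congr (_ * _); apply: eq_big => Y'.
    by rewrite sub0set /semiperimeter /= leq_subLR.
  case/andP => sY' lY'; rewrite (_ : has_large _ _ _) ?mulr1 //.
  apply/existsP; exists (X, Y'); rewrite lY' above_refl.
  by rewrite (rectS _ sY' rz).
under eq_bigr => Y' hY'.
  rewrite -sum_col_moebius; last by case/andP: hY' => sY' _; rewrite (rectS _ sY' rz).
  rewrite mulr_sumr; over.
rewrite (exchange_big_dep (fun w => large_rect w && above (X, Y) w)) /=; last first.
  move=> Y' w /andP[sY' _] /and3P[rw lw /andP[/= sX sw]].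
  by rewrite /large_rect /above rw lw /= sX (subset_trans sw sY').
rewrite (bigID (fun w => shrinks (X, Y) w)) /= [X in _ + X]big1 ?addr0; last first.
  move=> w /andP[/andP[/andP[rw lw] /andP[/= sX sY]] nsh].
  apply: big_pred0 => Y'; apply/negP => /andP[/andP[sY' small]].
  case/and3P => _ _ /andP[/= _ swY']; case/negP: nsh; rewrite /shrinks /=.
  rewrite !properEneq sX sY !andbT; apply/andP; split.
    apply: contraNneq small => ->; apply: leq_trans lw _.
    by rewrite /semiperimeter /= leq_add2l subset_leq_card.
  apply: contraNneq small => e; move: swY'; rewrite e => h.
  by have -> : Y' = Y by apply/eqP; rewrite eqEsubset sY' h.
rewrite mulr_sumr -sumrN; apply: eq_big => [w|w].
  rewrite /chain_step /shrinks /above /= !properE.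
  by case: (large_rect w); case: (X \subset w.1); case: (w.2 \subset Y); rewrite /= ?andbF.
case/andP => /andP[/andP[rw lw] /andP[/= sX sY]] /andP[/= pX pY].
under eq_bigr do rewrite mulrA.
rewrite -mulr_suml -mulr_suml row_coefE //=.
have hs : \sum_(Y' : {set J} | [&& (Y' \subset Y) && ~~ (N <= semiperimeter (X, Y'))%N,
      rect H w, (N <= semiperimeter w)%N & above (X, Y') w])
    (-1) ^+ (#|Y| + #|Y'|) = - ((-1) ^+ r * 'C((#|Y| - #|w.2|).-1, r)%:R) :> R.
  have := sum_sign_interval R w.2 Y.
  rewrite (_ : (w.2 == Y) = false); last by apply: contraTF pY => /eqP ->; rewrite properxx.
  have tw : (N - #|X| <= #|Y|)%N by [].
  rewrite rE -(sum_sign_large R pY tw).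
  rewrite (bigID (fun Y' : {set J} => (N <= semiperimeter (X, Y'))%N)) /= addrC => /eqP.
  rewrite addr_eq0 => /eqP e; apply: etrans (etrans e _).
    apply: eq_bigl => Y'; rewrite rw lw /above /= sX /=.
    by rewrite andbC andbA.
  congr (- _); apply: eq_bigl => Y'.
  by rewrite -andbA /semiperimeter /= leq_subLR.
rewrite hs !mulNr mulrN; congr (- _).
rewrite -!mulrA sqr; congr (_ * _).
by rewrite mulrCA.
Qed.

(** The sum over the chains that may follow z satisfies the recursion of
    [col_moebius_step]. *)
Lemma sum_chains_above f z : large_rect z -> (#|I| - #|z.1| <= f)%N ->
  \sum_(c <- chains chain_step f (chain_step z))
     (-1) ^+ size c * 'C((#|z.2| - next_width c).-1, semiperimeter z - N)%:R
       * chain_coef #|z.1| c =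
  (-1) ^+ (semiperimeter z - N) * col_moebius H N R z.
Proof.
elim: f z => [|f IHf] z gz zf; rewrite col_moebius_step //.
  rewrite /= big_seq1 /next_width /= cards0 subn0 mul1r mulr1 big_pred0 ?subr0 //.
  move=> w; apply/negP => /andP[_ /andP[/proper_card h _]].
  by have := max_card (pred_of_set w.1); lia.
rewrite big_chainsS /next_width /= cards0 subn0 mul1r mulr1; congr (_ + _).
rewrite -sumrN; apply: eq_bigr => w /andP[gw /andP[/proper_card h _]].
rewrite -IHf //; last by lia.
rewrite mulr_sumr -sumrN; apply: eq_bigr => c _ /=.
by rewrite exprS mulN1r !mulNr; congr (- _); ring.
Qed.

Lemma sum_chains f : (#|I| < f)%N ->
  \sum_(c <- chains chain_step f large_rect) (-1) ^+ size c * chain_coef 0 c =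
    1 - (has_large H N (set0, setT))%:R.
Proof.
case: f => // f fI; rewrite big_chainsS /= expr0 mulr1; congr (_ + _).
rewrite -[X in _ = - X]sum_col_moebius; last by apply/rectP => i j; rewrite inE.
rewrite -sumrN; apply: eq_big => [z|z gz].
  by rewrite /large_rect /above /= sub0set subsetT !andbT.
have /andP[rz lz] := gz.
have z2J : (#|z.2| <= #|J|)%N := max_card _.
have z1N0 : set0 \proper z.1.
  rewrite proper0 -card_gt0; move: lz ltJN; rewrite /semiperimeter; lia.
rewrite row_coefE // -mulrA [_%:R * _]mulrC mulrA.
rewrite -(sum_chains_above (f := f)) //; last first.
  by move: z1N0 => /proper_card; rewrite cards0; lia.
rewrite mulr_suml -sumrN; apply: eq_bigr => c _ /=; rewrite cards0.
by rewrite exprS mulN1r !mulNr; congr (- _); ring.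
Qed.

End ChainSum.

Local Open Scope nat_scope.

(** * Matchings and covers by lines *)

Section Konig.
Variables I J : finType.
Implicit Types (G M : {set I * J}) (A : {set I}) (C : {set J}).

Definition matching M : bool :=
  [forall e in M, forall f in M, (e != f) ==> (e.1 != f.1) && (e.2 != f.2)].

Definition covers A C G : bool := [forall e in G, (e.1 \in A) || (e.2 \in C)].

Lemma matchingP M :
  reflect {in M &, forall e f, e != f -> (e.1 != f.1) && (e.2 != f.2)}
    (matching M).
Proof.
apply: (iffP forall_inP) => [h e f eM fM|h e eM].
  by have /forall_inP/(_ f fM)/implyP := h e eM.
by apply/forall_inP => f fM; apply/implyP; exact: h.
Qed.

Lemma coversP A C G :
  reflect {in G, forall e, (e.1 \in A) || (e.2 \in C)} (covers A C G).
Proof. exact: forall_inP. Qed.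

Lemma matching_leq_cover M A C : matching M -> covers A C M ->
  #|M| <= #|A| + #|C|.
Proof.
move=> /matchingP mM /coversP cM.
have inj e f : e \in M -> f \in M -> (e.1 == f.1) || (e.2 == f.2) -> e = f.
  move=> eM fM; apply: contraTeq => nef.
  by rewrite negb_or mM.
have sM : M \subset [set e in M | e.1 \in A] :|: [set e in M | e.2 \in C].
  by apply/subsetP => e eM; rewrite !inE eM; exact: cM.
apply: leq_trans (subset_leq_card sM) (leq_trans (leq_card_setU _ _) _).
apply: leq_add.
  rewrite -(card_in_imset (f := fst)); last first.
    move=> e f; rewrite !inE => /andP[eM _] /andP[fM _] ef.
    by apply: inj => //; rewrite ef eqxx.
  by apply/subset_leq_card/subsetP => _ /imsetP[e eM ->]; move: eM; rewrite inE => /andP[].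
rewrite -(card_in_imset (f := snd)); last first.
  move=> e f; rewrite !inE => /andP[eM _] /andP[fM _] ef.
  by apply: inj => //; rewrite ef eqxx orbT.
by apply/subset_leq_card/subsetP => _ /imsetP[e eM ->]; move: eM; rewrite inE => /andP[].
Qed.

(** Take an inclusion-minimal subgraph that cannot be covered by fewer than k
    lines.  If it had two edges e, f in the same row r, then deleting either
    would leave a cover by fewer than k lines, (A, C) and (A', C').  Both
    (A u A' u {r}, C n C') and (A n A', C u C') cover the whole subgraph, and
    one of them has fewer than k lines.  The same holds for columns, so the
    subgraph is a matching, and as its rows cover it, it has at least k
    edges. *)
Lemma konig G k : (forall A C, covers A C G -> k <= #|A| + #|C|) ->
  exists M, [/\ M \subset G, matching M & #|M| = k].
Proof.
move=> hG.
pose P G' := [forall A, forall C, covers A C G' ==> (k <= #|A| + #|C|)].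
have PG : P G by apply/forallP => A; apply/forallP => C; apply/implyP; exact: hG.
have {PG} [G' /minsetP[PG' minG'] sG'G] := minset_exists PG.
have {PG'} PG' A C : covers A C G' -> k <= #|A| + #|C|.
  by move: PG' => /forallP/(_ A)/forallP/(_ C)/implyP.
have crit e : e \in G' -> exists A C,
    [/\ {in G', forall f, f != e -> (f.1 \in A) || (f.2 \in C)},
      e.1 \notin A, e.2 \notin C & #|A| + #|C| < k].
  move=> eG'; have : ~~ P (G' :\ e).
    apply/negP => /minG'; rewrite subD1set => /(_ isT) h.
    by have := setD11 e G'; rewrite h eG'.
  case/forallPn => A /forallPn[C]; rewrite negb_imply -ltnNge => /andP[/coversP cAC lt].
  have cAC' : {in G', forall f, f != e -> (f.1 \in A) || (f.2 \in C)}.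
    by move=> f fG' nfe; apply: cAC; rewrite !inE nfe.
  have : ~~ ((e.1 \in A) || (e.2 \in C)).
    apply/negP => he; suff : covers A C G' by move/PG'; rewrite leqNgt lt.
    by apply/coversP => f fG'; case: (eqVneq f e) => [->|]; last exact: cAC'.
  by rewrite negb_or => /andP[? ?]; exists A, C.
have mG' : matching G'.
  apply/matchingP => e f eG' fG' nef.
  have [A [C [cA eA eC ltA]]] := crit e eG'.
  have [A' [C' [cA' fA' fC' ltA']]] := crit f fG'.
  have nfe : f != e by rewrite eq_sym.
  have fAC := cA f fG' nfe; have eAC' := cA' e eG' nef.
  have both g : g \in G' -> g != e -> g != f ->
      ((g.1 \in A) || (g.2 \in C)) && ((g.1 \in A') || (g.2 \in C')).
    by move=> gG' ge gf; rewrite cA ?cA'.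
  have UA := cardsUI A A'; have UC := cardsUI C C'.
  (* The two covers c1 and c2 below have total size at most one more than that of the
     two covers of size less than k they come from. *)
  have absurd u i u' i' (b : bool) : u + i = #|A| + #|A'| ->
      u' + i' = #|C| + #|C'| -> k <= b + u + i' -> k <= i + u' -> False.
    by clear -ltA ltA'; case: b; lia.
  have absurd' u i u' i' (b : bool) : u + i = #|C| + #|C'| ->
      u' + i' = #|A| + #|A'| -> k <= b + u + i' -> k <= i + u' -> False.
    by clear -ltA ltA'; case: b; lia.
  apply/andP; split; apply/negP => /eqP ef.
    have c1 : covers (e.1 |: (A :|: A')) (C :&: C') G'.
      apply/coversP => g gG'; rewrite !inE; have [->|ge] := eqVneq g e.
        by rewrite eqxx.
      have [->|gf] := eqVneq g f; first by rewrite -ef eqxx.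
      by have := both g gG' ge gf; do 4!case: (_ \in _); rewrite /= ?orbT.
    have c2 : covers (A :&: A') (C :|: C') G'.
      apply/coversP => g gG'; rewrite !inE; have [->|ge] := eqVneq g e.
        by move: eAC'; rewrite ef (negPf fA') /= => ->; rewrite ?orbT.
      have [->|gf] := eqVneq g f.
        by move: fAC; rewrite -ef (negPf eA) /= => ->; rewrite ?orbT.
      by have := both g gG' ge gf; do 4!case: (_ \in _); rewrite /= ?orbT.
    by move/PG': c1; rewrite cardsU1 => /(absurd _ _ _ _ _ UA UC); apply; exact: PG'.
  have c1 : covers (A :&: A') (e.2 |: (C :|: C')) G'.
    apply/coversP => g gG'; rewrite !inE; have [->|ge] := eqVneq g e.
      by rewrite eqxx orbT.
    have [->|gf] := eqVneq g f; first by rewrite -ef eqxx orbT.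
    by have := both g gG' ge gf; do 4!case: (_ \in _); rewrite /= ?orbT.
  have c2 : covers (A :|: A') (C :&: C') G'.
    apply/coversP => g gG'; rewrite !inE; have [->|ge] := eqVneq g e.
      by move: eAC'; rewrite ef (negPf fC') orbF => ->; rewrite ?orbT.
    have [->|gf] := eqVneq g f.
      by move: fAC; rewrite -ef (negPf eC) orbF => ->; rewrite ?orbT.
    by have := both g gG' ge gf; do 4!case: (_ \in _); rewrite /= ?orbT.
  move/PG': c1; rewrite cardsU1 addnC => /(absurd' _ _ _ _ _ UC UA); apply.
  by rewrite addnC; exact: PG'.
have kG' : k <= #|G'|.
  have := PG' [set e.1 | e in G'] set0; rewrite cards0 addn0 => h.
  apply: leq_trans (h _) (leq_imset_card _ _).
  by apply/coversP => e eG'; rewrite imset_f.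
have : 0 < #|[set M : {set I * J} | M \subset G' & #|M| == k]|.
  by rewrite cards_draws bin_gt0.
case/card_gt0P => M; rewrite inE => /andP[sMG' /eqP cM].
exists M; split=> //; first exact: subset_trans sMG' sG'G.
apply/matchingP => e f eM fM.
by move/matchingP: mG'; apply; apply: (subsetP sMG').
Qed.

(** The uncovered rows and columns of a cover by fewer than k lines span a large
    rectangle in the complement of G, and conversely. *)
Lemma matching_has_large G k : k <= #|I| ->
  [exists M : {set I * J}, [&& matching M, #|M| == k & M \subset G]] =
    ~~ has_large (~: G) (#|I| + #|J| - k).+1 (set0, setT).
Proof.
move=> kI; apply/existsP/existsPn => [[M /and3P[mM /eqP cM sMG]] [X Y]|h].
  apply/negP => /and3P[/rectP rXY lXY _].
  have cov : covers (~: X) (~: Y) M.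
    apply/coversP => -[i j] eM; rewrite !inE -negb_and; apply/negP.
    by case/andP => iX jY; have := rXY i j iX jY; rewrite inE (subsetP sMG).
  have := matching_leq_cover mM cov.
  have := cardsC X; have := cardsC Y; move: lXY; rewrite /semiperimeter cM /=; lia.
have [|M [sMG mM cM]] := @konig G k; last first.
  by exists M; rewrite mM cM eqxx.
move=> A C /coversP cAC; rewrite leqNgt; apply/negP => lt.
have := h (~: A, ~: C); case/negP; apply/and3P; split.
- apply/rectP => i j; rewrite !inE => iA jC; apply/negP => /cAC /=.
  by rewrite (negPf iA) (negPf jC).
- have := cardsC A; have := cardsC C; rewrite /semiperimeter /=; clear -lt kI.
  move: #|~: A| #|~: C| #|A| #|C| #|I| #|J| lt kI; lia.
- by rewrite /above sub0set subsetT.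
Qed.

End Konig.

(** * Chains of maximal rectangles *)

Section MaximalRectangles.
Variables I J : finType.
Local Notation rectangle := ({set I} * {set J})%type.
Implicit Types (B : {set I * J}) (z : rectangle) (c : seq rectangle).

Definition maximal_rect B z : bool :=
  [&& z.1 != set0, z.2 != set0, rect (~: B) z,
    [forall i, [forall j in z.2, (i, j) \notin B] ==> (i \in z.1)] &
    [forall j, [forall i in z.1, (i, j) \notin B] ==> (j \in z.2)]].

(** When c is a chain, the set B such that the rectangles of c are the maximal
    rectangles in the complement of B. *)
Definition remainder c : {set I * J} :=
  [set e | ~~ has (fun z => (e.1 \in z.1) && (e.2 \in z.2)) c].

Definition nonempty_sides z : bool := (z.1 != set0) && (z.2 != set0).

Lemma maximal_rectP B z :
  reflect [/\ nonempty_sides z, {in z.1 & z.2, forall i j, (i, j) \notin B},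
    forall i, {in z.2, forall j, (i, j) \notin B} -> i \in z.1 &
    forall j, {in z.1, forall i, (i, j) \notin B} -> j \in z.2]
   (maximal_rect B z).
Proof.
apply: (iffP and5P) => [[a b /rectP h /forallP h1 /forallP h2]|[/andP[a b] h h1 h2]].
  split; first by apply/andP.
  - by move=> i j iz jz; have := h i j iz jz; rewrite inE.
  - by move=> i hi; apply: (implyP (h1 i)); apply/forall_inP.
  - by move=> j hj; apply: (implyP (h2 j)); apply/forall_inP.
split=> //.
- by apply/rectP => i j iz jz; rewrite inE h.
- by apply/forallP => i; apply/implyP => /forall_inP; exact: h1.
- by apply/forallP => j; apply/implyP => /forall_inP; exact: h2.
Qed.

(** Every cell outside B lies in a maximal rectangle: enlarge first its row and
    then its column as much as possible. *)
Lemma mem_remainder_maximal B c : c =i maximal_rect B -> remainder c = B.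
Proof.
move=> hc; apply/setP => -[i j]; rewrite inE; apply/hasPn/idP => [h|ijB z].
  apply/negPn/negP => nB.
  pose Y := [set j' | (i, j') \notin B].
  pose X := [set i' | [forall j' in Y, (i', j') \notin B]].
  have iX : i \in X by rewrite inE; apply/forall_inP => j'; rewrite inE.
  have jY : j \in Y by rewrite inE.
  suff : (X, Y) \in c by move=> /h; rewrite /= iX jY.
  rewrite hc; apply/maximal_rectP; split=> /=.
  - by apply/andP; split; apply/set0Pn; [exists i | exists j].
  - by move=> i' j'; rewrite inE => /forall_inP/(_ j').
  - by move=> i' h'; rewrite inE; apply/forall_inP.
  - by move=> j' /(_ i iX); rewrite inE.
rewrite hc => /maximal_rectP[_ hz _ _] /=; apply/negP => /andP[iz jz].
by have := hz i j iz jz; rewrite ijB.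
Qed.

Lemma shrinks_trans : transitive (@shrinks I J).
Proof.
move=> z2 z1 z3 /andP[a b] /andP[c d].
by rewrite /shrinks (proper_trans a c) (proper_trans d b).
Qed.

Lemma shrinks_irr : irreflexive (@shrinks I J).
Proof. by move=> z; rewrite /shrinks properxx. Qed.

Lemma sorted_shrinks_total c : sorted (@shrinks I J) c ->
  {in c &, forall z w, [|| z == w, shrinks z w | shrinks w z]}.
Proof.
elim: c => //= x c IHc px z w; have px' := order_path_min shrinks_trans px.
rewrite !inE => /orP[/eqP ->|zc] /orP[/eqP ->|wc].
- by rewrite eqxx.
- by rewrite (allP px' w wc) orbT.
- by rewrite (allP px' z zc) !orbT.
- by apply: IHc; rewrite ?(path_sorted px).
Qed.

(** The largest of the members strictly inside X contains all the others. *)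
Lemma chain_new_element (T : finType) (F : seq {set T}) (X : {set T}) :
    X != set0 -> {in F &, forall A B : {set T}, (A \subset B) || (B \subset A)} ->
    X \in F ->
  exists2 x, x \in X & {in F, forall A : {set T}, x \in A -> X \subset A}.
Proof.
move=> X0 hF XF; have [/hasP[A0 A0F pA0]|/hasPn hn] :=
    boolP (has (fun A : {set T} => A \proper X) F); last first.
  have /set0Pn[x xX] := X0; exists x => // A AF xA.
  have /orP[//|sAX] := hF X A XF AF.
  by have := hn A AF; rewrite properE sAX negbK.
pose P (A : {set T}) := (A \in F) && (A \proper X).
have PA0 : P A0 by rewrite /P A0F.
case: (arg_maxnP (fun A : {set T} => #|A|) PA0) => M /andP[MF pM] maxM.
have /properP[sM [x xX xM]] := pM; exists x => // A AF xA.
have /orP[//|sAX] := hF X A XF AF.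
apply/negPn/negP => nsXA; have PA : P A by rewrite /P AF properE sAX.
have /orP[sAM|sMA] := hF A M AF MF; first by rewrite (subsetP sAM) in xM.
have : #|A| <= #|M| := maxM A PA; rewrite leqNgt => /negP; apply; apply: proper_card.
by apply/properP; split=> //; exists x.
Qed.

(** If X is not inside the rows of the first rectangle, some row of X meets only
    later ones; these have all the rows of the first rectangle, which can thus be
    dropped from the cover. *)
Lemma rect_in_chain c X Y : sorted (@shrinks I J) c -> X != set0 -> Y != set0 ->
    {in X & Y, forall i j, has (fun z => (i \in z.1) && (j \in z.2)) c} ->
  exists z, [/\ z \in c, X \subset z.1 & Y \subset z.2].
Proof.
move=> + /set0Pn[i0 i0X] /set0Pn[j0 j0Y].
elim: c => [|z c IHc] /= pz cov; first by have := cov i0 j0 i0X j0Y.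
have pz' := order_path_min shrinks_trans pz.
have [sXz|/subsetPn[i iX iz]] := boolP (X \subset z.1).
  exists z; rewrite mem_head; split=> //; apply/subsetP => j jY.
  have /orP[/andP[]//|/hasP[w wc /andP[_ jw]]] := cov i0 j i0X jY.
  by have /andP[_ /proper_sub/subsetP] := allP pz' w wc; apply.
have [//||w [wc sXw sYw]] := IHc; first exact: path_sorted pz.
  move=> i' j i'X jY.
  have /orP[/andP[i'z jz]|//] := cov i' j i'X jY.
  have := cov i j iX jY; rewrite (negPf iz) /= => /hasP[w wc /andP[_ jw]].
  apply/hasP; exists w; rewrite // jw andbT.
  by have /andP[/proper_sub/subsetP h _] := allP pz' w wc; apply: h.
by exists w; rewrite inE wc orbT.
Qed.

(** A rectangle z of the chain has a column in none of the narrower ones and a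
    row in none of the shorter ones; the first prevents z from growing in rows,
    the second in columns.  Conversely a maximal rectangle is covered by the
    chain, hence contained in one of its members by [rect_in_chain]. *)
Lemma maximal_rect_remainder c : sorted (@shrinks I J) c -> all nonempty_sides c ->
  c =i maximal_rect (remainder c).
Proof.
move=> sc ne z; apply/idP/maximal_rectP => [zc|[/andP[z1 z2] hz h1 h2]].
  have /andP[z1 z2] := allP ne z zc.
  have cmp := sorted_shrinks_total sc.
  split; first by rewrite (allP ne).
  - move=> i j iz jz; rewrite inE negbK; apply/hasP.
    by exists z; rewrite ?iz.
  - have [||j jz hj] := @chain_new_element _ [seq w.2 | w <- c] z.2 z2.
    + move=> _ _ /mapP[w wc ->] /mapP[v vc ->].
      have := cmp w v wc vc.
      by case/or3P=> [/eqP ->|/andP[_ /proper_sub ->]|/andP[_ /proper_sub ->]];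
        rewrite ?subxx ?orbT.
    + exact: map_f.
    move=> i /(_ j jz); rewrite inE negbK => /hasP[w wc /andP[iw jw]].
    have szw := hj w.2 (map_f _ wc) jw.
    have := cmp z w zc wc.
    case/or3P => [/eqP -> //|/andP[_]|/andP[/proper_sub/subsetP h _]]; last exact: h.
    by rewrite properE szw andbF.
  - have [||i iz hi] := @chain_new_element _ [seq w.1 | w <- c] z.1 z1.
    + move=> _ _ /mapP[w wc ->] /mapP[v vc ->].
      have := cmp w v wc vc.
      by case/or3P=> [/eqP ->|/andP[/proper_sub -> _]|/andP[/proper_sub -> _]];
        rewrite ?subxx ?orbT.
    + exact: map_f.
    move=> j /(_ i iz); rewrite inE negbK => /hasP[w wc /andP[iw jw]].
    have szw := hi w.1 (map_f _ wc) iw.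
    have := cmp z w zc wc.
    case/or3P => [/eqP -> //|/andP[_ /proper_sub/subsetP h]|/andP[]]; first exact: h.
    by rewrite properE szw andbF.
have [|w [wc s1 s2]] := rect_in_chain sc z1 z2.
  by move=> i j iz jz; have := hz i j iz jz; rewrite inE negbK.
suff -> : z = w by [].
case: z w {z1 z2} wc s1 s2 hz h1 h2 => [X Y] [A C] /= wc sXA sYC hz h1 h2.
have hw : {in A & C, forall i j, (i, j) \notin remainder c}.
  by move=> i j iA jC; rewrite inE negbK; apply/hasP; exists (A, C); rewrite //= iA.
congr (_, _); apply/eqP; rewrite eqEsubset ?sXA ?sYC /=; apply/subsetP.
  by move=> i iA; apply: h1 => j jY; apply: hw => //; exact: (subsetP sYC).
by move=> j jC; apply: h2 => i iX; apply: hw => //; exact: (subsetP sXA).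
Qed.

Lemma remainder_nested c (i i' : I) : sorted (@shrinks I J) c ->
  (forall j, (i, j) \in remainder c -> (i', j) \in remainder c) \/
  (forall j, (i', j) \in remainder c -> (i, j) \in remainder c).
Proof.
move=> sc; have cmp := sorted_shrinks_total sc.
have [/hasP[z zc /andP[iz i'z]]|/hasPn hn] :=
  boolP (has (fun z => (i \in z.1) && (i' \notin z.1)) c); last first.
  right=> j; rewrite !inE; apply: contra => /hasP[z zc /andP[iz jz]].
  apply/hasP; exists z; rewrite // jz andbT; have := hn z zc.
  by rewrite iz negbK.
left=> j; rewrite !inE; apply: contra => /hasP[w wc /andP[/= i'w jw]].
apply/hasP; exists z; rewrite //= iz /=.
have := cmp z w zc wc; case/or3P => [/eqP -> //|/andP[_ /proper_sub/subsetP]|]; first exact.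
by case/andP => /proper_sub/subsetP/(_ _ i'w); rewrite (negPf i'z).
Qed.

End MaximalRectangles.

(** * Inner corners and maximal rectangles *)

Section Corners.
Variables m n : nat.
Implicit Types (lam : {ffun 'I_m -> 'I_n.+1}) (B : {set edge m n}).
Implicit Types (i : 'I_m) (q : nat).

Lemma is_partitionP lam :
  reflect (forall i i', i <= i' -> lam i' <= lam i) (is_partition lam).
Proof.
apply: (iffP 'forall_forallP) => [h i i'|h i i']; first exact/implyP.
by apply/implyP; exact: h.
Qed.

Lemma has_shapeP B lam :
  reflect (is_partition lam /\ exists (s : 'S_m) (u : 'S_n),
             forall e, (e \in B) = (u e.2 < lam (s e.1)))
          (has_shape B lam).
Proof.
apply: (iffP andP) => -[plam h]; split=> //.
  move: h => /existsP[s /existsP[u /eqP h]]; exists s, u => e.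
  move/setP/(_ (s e.1, u e.2)): h; rewrite inE /= => <-.
  rewrite (mem_imset (f := fun e : edge m n => (s e.1, u e.2))) //.
  by move=> [a b] [a' b'] [/perm_inj -> /perm_inj ->].
move: h => [s [u h]]; apply/existsP; exists s; apply/existsP; exists u.
apply/eqP/setP => -[a b]; rewrite inE /=; apply/imsetP/idP.
  by case=> e eB [-> ->]; rewrite -h.
move=> lt; exists ((s^-1)%g a, (u^-1)%g b); last by rewrite /= !permKV.
by rewrite h /= !permKV.
Qed.

Lemma cellE lam i q : cell lam i.+1 q.+1 = (q < lam i).
Proof.
apply/exists_inP/idP => [[[i' j]]|lt].
  by rewrite inE /= => lt /andP[/eqP[/val_inj <-] /eqP[<-]].
have qn : q < n by apply: leq_trans lt _; rewrite -ltnS.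
by exists (i, Ordinal qn); rewrite ?inE //= !eqxx.
Qed.

(** An inner corner sits at the end of a row of the diagram and is the highest
    one at that width, so the inner corners correspond to the distinct row
    lengths less than n. *)
Lemma inner_cornerE lam i q : is_partition lam ->
  inner_corner lam (i : nat, q) =
    [&& q < n, lam i == q :> nat & [forall i' : 'I_m, (i' < i) ==> (q < lam i')]].
Proof.
move=> /is_partitionP plam; rewrite /inner_corner ltn_ord cellE -leqNgt /=.
congr (_ && _).
have -> : (q == 0) || cell lam i.+1 q = (q <= lam i).
  by case: q => //= q; rewrite cellE.
rewrite (eqn_leq (lam i) q); case: (lam i <= q) => //=; rewrite andbC; congr (_ && _).
apply/idP/forall_inP.
  case: i => -[|i] im //= + i' lti'.
  by rewrite (cellE lam (Ordinal (ltnW im))) => /leq_trans; apply; apply: plam.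
case: i => -[|i] im //= h.
by rewrite (cellE lam (Ordinal (ltnW im))) h.
Qed.

Lemma mem_inner_corners lam p q :
  ((p, q) \in inner_corners lam) = inner_corner lam (p, q).
Proof.
rewrite mem_filter; apply: andb_idr => /and5P[pm qn _ _ _].
by rewrite allpairs_f // ?mem_rev mem_iota.
Qed.

Lemma ex_inner_corner lam i : is_partition lam -> lam i < n ->
  exists2 i' : 'I_m, i' <= i & inner_corner lam (i' : nat, lam i : nat).
Proof.
move=> plam lin.
pose P i' := (i' <= i) && (lam i' == lam i).
have Pi : P i by rewrite /P leqnn eqxx.
case: (arg_minnP (fun i' : 'I_m => i') Pi) => i0 /andP[le0 /eqP e0] min0.
exists i0 => //; rewrite inner_cornerE // lin e0 eqxx /=.
apply/forall_inP => i' lt; rewrite ltn_neqAle.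
move/is_partitionP: plam => plam.
rewrite (plam i' i) ?(leq_trans (ltnW lt)) // andbT.
apply/eqP => e; have := min0 i'; rewrite /P (leq_trans (ltnW lt)) //=.
have -> : lam i' = lam i by apply: val_inj.
by rewrite eqxx => /(_ isT); rewrite leqNgt lt.
Qed.

Lemma pairwise_allpairs (ps qs : seq nat) :
  pairwise gtn ps -> pairwise ltn qs ->
  pairwise (fun c d : nat * nat => (d.1 < c.1) || (c.1 == d.1) && (c.2 < d.2))
    [seq (p, q) | p <- ps, q <- qs].
Proof.
move=> + hq; elim: ps => //= p ps IHp /andP[hp pps].
rewrite pairwise_cat IHp // andbT; apply/andP; split.
  apply/allrelP => _ _ /mapP[q _ ->] /allpairsP[[p' q'] [/= p'ps _ ->]] /=.
  by have := allP hp p' p'ps => /= ->.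
rewrite pairwise_map; apply: sub_pairwise hq => q q' /=.
by rewrite eqxx => ->; rewrite orbT.
Qed.

Lemma pairwise_inner_corners lam : is_partition lam ->
  pairwise (fun c d : nat * nat => (d.1 < c.1) && (c.2 < d.2)) (inner_corners lam).
Proof.
move=> plam; have : pairwise (fun c d : nat * nat =>
    (d.1 < c.1) || (c.1 == d.1) && (c.2 < d.2)) (inner_corners lam).
  apply: pairwise_filter; apply: pairwise_allpairs.
    by rewrite -sorted_pairwise ?rev_sorted ?iota_ltn_sorted //;
      move=> a b c /= h1 h2; exact: ltn_trans h2 h1.
  by rewrite -sorted_pairwise ?iota_ltn_sorted //; exact: ltn_trans.
apply: (sub_in_pairwise (P := mem (inner_corners lam))); last exact/allP.
move=> [p q] [p' q'] /=; rewrite ![_ \in _]mem_inner_corners => h h'.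
have /and3P[pm _ _] := h; have /and3P[pm' _ _] := h'.
move: h h'; rewrite (inner_cornerE (Ordinal pm)) // (inner_cornerE (Ordinal pm')) //=.
case/and3P => _ /eqP eq /forall_inP hq /and3P[_ /eqP eq' /forall_inP hq'].
case/orP => [lt|/andP[/eqP e lt]].
  by rewrite lt /= -eq'; exact: hq (Ordinal pm') lt.
move: pm' eq' {hq'}; rewrite -e => pm'; rewrite (bool_irrelevance pm' pm) eq => eqq.
by rewrite eqq ltnn in lt.
Qed.

Lemma card_perm_geq k (s : 'S_k) p : #|[set r | p <= s r]| = k - p.
Proof.
have -> : [set r | p <= s r] = s @^-1: [set i : 'I_k | p <= i].
  by apply/setP => r; rewrite !inE.
rewrite card_preimset; last exact: perm_inj.
rewrite -sum1_card (eq_bigl (fun i : 'I_k => p <= i)); last by move=> i; rewrite inE.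
by rewrite -(big_geq_mkord p k xpredT (fun=> 1)) sum_nat_const_nat muln1.
Qed.

Lemma card_ord_lt k p : p <= k -> #|[set r : 'I_k | r < p]| = p.
Proof.
move=> le; have := cardsC [set r : 'I_k | r < p]; rewrite card_ord.
have -> : ~: [set r : 'I_k | r < p] = [set r : 'I_k | p <= (1%g : 'S_k) r].
  by apply/setP => r; rewrite !inE perm1 -leqNgt.
by rewrite card_perm_geq -[X in _ = X](subnK le) addnC => /addnI.
Qed.

Lemma proper_perm_geq k (s : 'S_k) p p' : p < p' -> p < k ->
  [set r | p' <= s r] \proper [set r | p <= s r].
Proof.
move=> lt pk; apply/properP; split.
  by apply/subsetP => r; rewrite !inE; apply: leq_trans; exact: ltnW.
by exists ((s^-1)%g (Ordinal pk)); rewrite inE permKV //= -ltnNge.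
Qed.

(** The cells below and to the right of c, before the permutations s of the rows
    and u of the columns that bring B into the shape of a diagram. *)
Definition corner_rect (s : 'S_m) (u : 'S_n) (c : nat * nat) :
    {set 'I_m} * {set 'I_n} :=
  ([set r | c.1 <= s r], [set j | c.2 <= u j]).

Definition corner_of (z : {set 'I_m} * {set 'I_n}) : nat * nat :=
  (m - #|z.1|, n - #|z.2|).

Lemma corner_rectK lam s u : {in inner_corners lam, cancel (corner_rect s u) corner_of}.
Proof.
move=> [p q]; rewrite mem_inner_corners => /and5P[pm qn _ _ _].
by rewrite /corner_of /= !card_perm_geq !subKn // ltnW.
Qed.

Lemma sorted_corner_rects lam s u : is_partition lam ->
  sorted (@shrinks _ _) [seq corner_rect s u c | c <- inner_corners lam].
Proof.
move=> plam; apply: pairwise_sorted; rewrite pairwise_map.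
apply: (sub_in_pairwise (P := mem (inner_corners lam))) (pairwise_inner_corners plam);
  last exact/allP.
move=> [p q] [p' q'] /=; rewrite ![_ \in _]mem_inner_corners.
move=> /and5P[pm qn _ _ _] /and5P[pm' qn' _ _ _] /andP[lt1 lt2].
by rewrite /shrinks !proper_perm_geq.
Qed.

(** The first row p and the first column q of a maximal rectangle, in the
    order of the diagram, form an inner corner, since rows and columns of a
    diagram are nested. *)
Lemma corner_rects_maximal lam (s : 'S_m) (u : 'S_n) B : is_partition lam ->
    (forall e, (e \in B) = (u e.2 < lam (s e.1))) ->
  [seq corner_rect s u c | c <- inner_corners lam] =i maximal_rect B.
Proof.
move=> plam hB z; have /is_partitionP mono := plam.
apply/mapP/maximal_rectP => [[[p q] + ->]|].
  rewrite mem_inner_corners => h; have /and3P[pm _ _] := h.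
  move: h; rewrite (inner_cornerE (Ordinal pm)) // => /and3P[qn /eqP eq /forall_inP hq].
  split; rewrite /nonempty_sides /=.
  - rewrite -!card_gt0 !card_perm_geq !subn_gt0 pm qn //.
  - move=> r j; rewrite !inE => hr hj; rewrite hB -leqNgt /=.
    by apply: leq_trans hj; rewrite -eq; apply: mono.
  - move=> r /(_ ((u^-1)%g (Ordinal qn))); rewrite !inE permKV leqnn => /(_ isT).
    rewrite hB /= permKV /= -leqNgt leqNgt => hr; rewrite leqNgt.
    by apply: contra hr; exact: hq.
  - move=> j /(_ ((s^-1)%g (Ordinal pm))); rewrite !inE permKV leqnn => /(_ isT).
    by rewrite hB /= permKV -leqNgt eq.
case: z => X Y [/andP[/= X0 Y0] hz h1 h2].
have /set0Pn[r0 r0X] := X0; have /set0Pn[j0 j0Y] := Y0.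
case: (arg_minnP (fun r => s r) r0X) => r rX minr.
case: (arg_minnP (fun j => u j) j0Y) => j jY minj.
have eX : X = [set r' | s r <= s r'].
  apply/setP => r'; rewrite inE; apply/idP/idP => [|h]; first exact: minr.
  apply: h1 => j' j'Y; have := hz r j' rX j'Y; rewrite !hB /= -!leqNgt.
  by apply: leq_trans; exact: mono.
have eY : Y = [set j' | u j <= u j'].
  apply/setP => j'; rewrite inE; apply/idP/idP => [|h]; first exact: minj.
  apply: h2 => r' r'X; have := hz r' j r'X jY; rewrite !hB /= -!leqNgt => h'.
  exact: leq_trans h.
exists (s r : nat, u j : nat); last by rewrite /corner_rect /= -eX -eY.
rewrite mem_inner_corners inner_cornerE // ltn_ord /=.
have le : lam (s r) <= u j by have := hz r j rX jY; rewrite hB -leqNgt.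
apply/andP; split.
  rewrite eqn_leq le /=; case e: (u j : nat) => [//|q].
  have qn : q < n by rewrite ltnW // -e.
  have : (u^-1)%g (Ordinal qn) \notin Y by rewrite eY inE permKV /= e ltnn.
  rewrite ltnNge; apply: contra => h; apply: h2 => r' r'X.
  rewrite hB /= permKV /= -leqNgt; apply: leq_trans h; apply: mono.
  by rewrite eX inE in r'X.
apply/forall_inP => i lt.
have : (s^-1)%g i \notin X by rewrite eX inE permKV -ltnNge.
rewrite ltnNge; apply: contra => h; apply: h1 => j' j'Y.
rewrite hB /= permKV -leqNgt; apply: leq_trans h _.
by rewrite eY inE in j'Y.
Qed.

Lemma ex_sorting_perm k (h : 'I_k -> nat) :
  exists s : 'S_k, forall i j : 'I_k, s i <= s j -> h j <= h i.
Proof.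
pose leh (i j : 'I_k) := h j <= h i; pose r := sort leh (enum 'I_k).
have mem_r (i : 'I_k) : i \in r by rewrite mem_sort mem_enum.
have size_r : size r = k by rewrite size_sort size_enum_ord.
have lt_r (i : 'I_k) : index i r < k by rewrite -[X in _ < X]size_r index_mem.
have inj : injective (fun i : 'I_k => Ordinal (lt_r i)).
  move=> i j [/(congr1 (nth i r))]; rewrite nth_index // => ->.
  by rewrite nth_index.
exists (perm inj) => i j; rewrite !permE /= => le_ij.
have leh_tr : transitive leh by move=> b a c hab hbc; exact: leq_trans hbc hab.
have sorted_r : sorted leh r by apply: sort_sorted => a b; exact: leq_total.
have := sorted_leq_nth leh_tr (fun a => leqnn _) i sorted_r.
move=> /(_ (index i r) (index j r)); rewrite !inE !index_mem !mem_r.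
by rewrite !nth_index //; apply.
Qed.

(** Sort the rows and the columns by decreasing size.  Nestedness makes every
    column that meets a given row larger than every column that does not, so each
    row becomes an initial segment. *)
Lemma has_shape_nested B :
    (forall i i', (forall j, (i, j) \in B -> (i', j) \in B) \/
                  (forall j, (i', j) \in B -> (i, j) \in B)) ->
  exists lam, has_shape B lam.
Proof.
move=> nested.
pose row_set i := [set j | (i, j) \in B]; pose col_set j := [set i | (i, j) \in B].
have [s hs] := ex_sorting_perm (fun i => #|row_set i|).
have [u hu] := ex_sorting_perm (fun j => #|col_set j|).
have row_le i : #|row_set i| < n.+1.
  by rewrite ltnS -[X in _ <= X]card_ord max_card.
exists [ffun i => Ordinal (row_le ((s^-1)%g i))]; apply/has_shapeP; split.
  by apply/is_partitionP => i i' le; rewrite !ffunE /= hs // !permKV.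
exists s, u => -[i j] /=; rewrite ffunE /= permK.
have lt_u j1 j2 : j1 \in row_set i -> j2 \notin row_set i -> u j1 < u j2.
  rewrite !inE => in1 nin2; rewrite ltnNge; apply/negP => /hu; rewrite leqNgt.
  case/negP; apply: proper_card; apply/properP; split; last by exists i; rewrite inE.
  apply/subsetP => i'; rewrite !inE => in2.
  have [h|h] := nested i i'; first exact: h.
  by rewrite (h _ in2) in nin2.
have cu (A : {set 'I_n}) : #|u @: A| = #|A| by apply: card_imset; exact: perm_inj.
rewrite -[(i, j) \in B](_ : (j \in row_set i) = _); last by rewrite inE.
apply/idP/idP => [jR|].
  rewrite -cu -[X in X <= _](card_ord_lt (ltn_ord (u j))).
  apply/subset_leq_card/subsetP => l; rewrite inE ltnS => le_l.
  apply/imsetP; exists ((u^-1)%g l); last by rewrite permKV.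
  apply: contraLR le_l => nl; rewrite -ltnNge.
  by have := lt_u _ _ jR nl; rewrite permKV.
rewrite ltnNge -cu; apply: contraNT => jR.
rewrite -[X in _ <= X](card_ord_lt (ltnW (ltn_ord (u j)))).
by apply/subset_leq_card/subsetP => _ /imsetP[l lR ->]; rewrite inE lt_u.
Qed.

End Corners.

(** * The sum of S(B) over the tabloidal sets containing a graph *)

Section TabloidIdentity.
Variables (m n k : nat) (R : realType).
Hypothesis k_range : 1 <= k <= minn m n.
Local Notation rectangle := ({set 'I_m} * {set 'I_n})%type.
Local Notation N := (m + n - k).+1.
Implicit Types (lam : {ffun 'I_m -> 'I_n.+1}) (B G : {set edge m n}).
Implicit Types (z : rectangle) (c : seq rectangle).

Let k_bounds : [/\ 1 <= k, k <= m & k <= n].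
Proof. by move: k_range; rewrite leq_min => /and3P[]. Qed.

Let side_bounds z : #|z.1| <= m /\ #|z.2| <= n.
Proof. by rewrite -[X in _ <= X]card_ord -[X in _ /\ _ <= X]card_ord !max_card. Qed.

Lemma corner_of_semiperimeter z :
  (((corner_of z).1 + (corner_of z).2) < k) = (N <= semiperimeter z).
Proof.
rewrite /corner_of /semiperimeter /=; have [] := side_bounds z; have [] := k_bounds.
move: #|z.1| #|z.2| => a b; lia.
Qed.

Lemma prod_corner_coef x c : x <= m -> all (fun z => N <= semiperimeter z) c ->
  (\prod_(0 <= i < size c)
    (('C((nth 0 (m - x :: [seq (corner_of z).1 | z <- c]) i
          - nth 0 [seq (corner_of z).1 | z <- c] i).-1,
        (k - nth 0 [seq (corner_of z).1 | z <- c] i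
           - nth n [seq (corner_of z).2 | z <- c] i).-1))%N%:R *
     ('C((nth n [seq (corner_of z).2 | z <- c] i.+1
          - nth n [seq (corner_of z).2 | z <- c] i).-1,
        (k - nth 0 [seq (corner_of z).1 | z <- c] i
           - nth n [seq (corner_of z).2 | z <- c] i).-1))%N%:R))%R
  = chain_coef N R x c.
Proof.
elim: c x => [|z c IHc] x xm /=; first by rewrite big_nil.
case/andP => lz lc; rewrite big_nat_recl //= IHc //; last by case: (side_bounds z).
have [zm zn] := side_bounds z; have [k1 km kn] := k_bounds.
congr (_ * _)%R; rewrite /next_width.
have -> : (k - (m - #|z.1|) - (n - #|z.2|)).-1 = semiperimeter z - N.
  by move: lz; rewrite /semiperimeter; move: #|z.1| #|z.2| zm zn => a b; lia.
have -> : m - x - (m - #|z.1|) = #|z.1| - x by move: #|z.1| zm => a; lia.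
congr (_ * 'C(_.-1, _)%:R)%R.
case: c {lc IHc} => [|w c] /=; first by rewrite cards0; move: #|z.2| zn => b; lia.
have [_ wn] := side_bounds w; move: #|z.2| #|w.2| zn wn => b b'; lia.
Qed.

Lemma S_coef_chain B c : inner_corners (tab_shape B) = map (@corner_of m n) c ->
    all (fun z => N <= semiperimeter z) c ->
  S_coef R k B = (- ((-1) ^+ size c * chain_coef N R 0 c))%R.
Proof.
move=> e lc; rewrite /S_coef /num_inner e size_map exprS mulN1r mulNr.
congr (- (_ * _))%R; rewrite big_add1 /=.
rewrite -prod_corner_coef // subn0; apply: eq_bigr => i _.
by rewrite /mid_m /mid_n /mid_k /corner_p /corner_q /= e -!map_comp.
Qed.

(** The outer corner (p, q) that violates the condition lies between two inner
    corners, the lower of which is in row p.  As the next inner corner is in a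
    column at most q, the mid rectangle of the lower one, (p, q'), has at most
    q - q' columns, fewer than k - p - q', and its second binomial coefficient
    vanishes. *)
Lemma S_coef_outer_eq0 B : is_partition (tab_shape B) ->
    ~~ all (fun d : nat * nat => k <= d.1 + d.2) (outer_corners (tab_shape B)) ->
  S_coef R k B = 0%R.
Proof.
rewrite /S_coef; set lam := tab_shape B => plam /allPn[[p q]].
have mono := elimT (is_partitionP _) plam.
have [k1 km kn] := k_bounds.
rewrite mem_filter -ltnNge => /andP[/and5P[/andP[p0 pm] /andP[q0 qn] h1 h2 h3] _] /= ltk.
case: p p0 pm h1 h2 h3 ltk => // p _ pm h1 h2 h3 ltk.
case: q q0 qn h1 h2 h3 ltk => // q _ qn h1 h2 h3 ltk.
have pm2 : p.+1 < m by lia.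
pose i := Ordinal pm; pose i2 := Ordinal pm2.
move: h1 h2 h3; rewrite (cellE lam i) (cellE lam i2) (cellE lam i) -!leqNgt => h1 h2 h3.
have li : lam i = q.+1 :> nat by apply/eqP; rewrite eqn_leq h3 h1.
have c1 : (p.+1, lam i2 : nat) \in inner_corners lam.
  rewrite mem_inner_corners (inner_cornerE i2) // eqxx (leq_ltn_trans h2) //=.
  apply/forall_inP => i' lt'; apply: leq_trans (mono _ i _); first by rewrite li.
  by rewrite -ltnS.
have [|i' lei' c2] := ex_inner_corner (lam := lam) (i := i) plam; first by rewrite li; lia.
move: c2; rewrite li -mem_inner_corners => c2.
have srt := elimT (pairwiseP (0,0)) (pairwise_inner_corners plam).
set ic := inner_corners lam in c1 c2 srt *.
pose a := index (p.+1, lam i2 : nat) ic; pose b := index (i' : nat, q.+1) ic.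
have asz : a < size ic by rewrite index_mem.
have bsz : b < size ic by rewrite index_mem.
have na : nth (0, 0) ic a = (p.+1, lam i2 : nat) by rewrite nth_index.
have nb : nth (0, 0) ic b = (i' : nat, q.+1) by rewrite nth_index.
have ab : a < b.
  case: (ltngtP a b) => // [ltba|eab].
    have := srt b a bsz asz ltba; rewrite na nb /= => /andP[].
    by move: lei' => /=; lia.
  by move: na; rewrite eab nb => -[e1 _]; move: lei'; rewrite e1 /= ltnn.
have qle : nth n [seq d.2 | d <- ic] a.+1 <= q.+1.
  rewrite (nth_map (0, 0)) ?(leq_ltn_trans ab) //.
  have -> : q.+1 = (nth (0, 0) ic b).2 by rewrite nb.
  move: ab; rewrite leq_eqVlt => /orP[/eqP -> //|ab].
  by have /andP[_ /ltnW] := srt a.+1 b (ltn_trans ab bsz) bsz ab.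
have z0 : 'C((mid_n lam a.+1).-1, (mid_k k lam a.+1).-1) = 0.
  rewrite bin_small // /mid_n /mid_k /corner_p /corner_q /=.
  rewrite -/ic (nth_map (0, 0) 0) // [nth n _ a](nth_map (0, 0)) // na /=.
  move: (nth n _ _) (lam i2 : nat) qle h2 => x y; lia.
rewrite (bigD1_seq a.+1) ?mem_index_iota ?iota_uniq ?ltnS //=.
by rewrite z0 mulr0 mul0r mulr0.
Qed.

(** The chosen shape may be any one that B has: its corners are determined by the
    maximal rectangles in the complement of B. *)
Lemma tab_shape_chain B lam : has_shape B lam ->
  exists c, [/\ sorted (@shrinks _ _) c, c =i maximal_rect B,
    inner_corners (tab_shape B) = map (@corner_of m n) c & is_partition (tab_shape B)].
Proof.
move=> hlam; have : has_shape B (tab_shape B).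
  by rewrite /tab_shape; case: pickP => //= /(_ lam); rewrite hlam.
move: (tab_shape B) => {hlam} {}lam /has_shapeP[plam [s [u hB]]].
exists [seq corner_rect s u d | d <- inner_corners lam]; split=> //.
- exact: sorted_corner_rects.
- exact: corner_rects_maximal.
rewrite -map_comp -[LHS]map_id; apply/eq_in_map => d hd.
by rewrite /= (corner_rectK s u hd).
Qed.

Section Chains.
Variable G : {set edge m n}.
Local Notation large_rect := (large_rect (~: G) N).

Lemma large_rect_nonempty_sides z : large_rect z -> nonempty_sides z.
Proof.
case/andP => _; have [] := side_bounds z; have [] := k_bounds.
rewrite /nonempty_sides -!card_gt0 /semiperimeter; move: #|z.1| #|z.2| => a b; lia.
Qed.

Lemma size_shrinks z c : path (@shrinks _ _) z c -> size c + #|z.1| <= m.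
Proof.
elim: c z => [|w c IHc] z /=; first by case: (side_bounds z).
case/andP => /andP[/proper_card lt _] /IHc; move: #|z.1| #|w.1| lt => a b; lia.
Qed.

Lemma mem_large_chains c : (c \in chains (chain_step (~: G) N) m.+1 large_rect) =
  sorted (@shrinks _ _) c && all large_rect c.
Proof.
have pathE z c' : path (chain_step (~: G) N) z c' =
    path (@shrinks _ _) z c' && all large_rect c'.
  elim: c' z => //= w c' IHc z; rewrite IHc /chain_step.
  by case: (large_rect w); case: (shrinks z w); rewrite //= andbF.
rewrite mem_chains; case: c => // z c; rewrite pathE /=.
case pz: (path _ z c); last by rewrite !andbF.
have -> : size c < m.+1 by have := size_shrinks pz; rewrite ltnS; lia.
by [].
Qed.

Definition tabloid_chains :=
  [seq c <- chains (chain_step (~: G) N) m.+1 large_rect | c != [::]].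

Lemma chain_maximal c : c \in tabloid_chains -> c =i maximal_rect (remainder c).
Proof.
rewrite mem_filter mem_large_chains => /and3P[_ sc gc].
apply: maximal_rect_remainder => //; apply: sub_all gc; exact: large_rect_nonempty_sides.
Qed.

Lemma tab_shape_remainder c : c \in tabloid_chains ->
  [/\ inner_corners (tab_shape (remainder c)) = map (@corner_of m n) c,
      is_partition (tab_shape (remainder c)) & tabloidal (remainder c)].
Proof.
move=> cc; have hc := chain_maximal cc.
move: cc; rewrite mem_filter mem_large_chains => /and3P[c0 sc gc].
have [lam hlam] := has_shape_nested (fun i i' => remainder_nested i i' sc).
have [c' [sc' hc' eic plam]] := tab_shape_chain hlam.
have ec : c' = c.
  apply: (irr_sorted_eq (@shrinks_trans _ _) (@shrinks_irr _ _)) => // z.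
  by rewrite hc hc'.
rewrite eic ec; split=> //; apply/andP; split; last by apply/existsP; exists lam.
case: c c0 gc {plam ec hc hc' sc hlam eic} => // z c _ /= /andP[gz _].
have /andP[/set0Pn[i iz] /set0Pn[j jz]] := large_rect_nonempty_sides gz.
apply/eqP => /setP/(_ (i, j)).
by rewrite !inE /= iz jz.
Qed.

(** Two chains with the same remainder have the same members, the maximal
    rectangles of its complement, and therefore coincide; and every tabloidal set
    is the remainder of the chain of its corner rectangles. *)
Lemma sum_tabloid_chains :
  (\sum_(B in Tabloid m n k | G \subset B) S_coef R k B =
   \sum_(c <- tabloid_chains) S_coef R k (remainder c))%R.
Proof.
pose T0 := [set B | [&& tabloidal B, G \subset B &
  all (fun d : nat * nat => d.1 + d.2 < k) (inner_corners (tab_shape B))]].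
have -> : (\sum_(B in Tabloid m n k | G \subset B) S_coef R k B =
           \sum_(B in T0) S_coef R k B)%R.
  rewrite [RHS](bigID (mem (Tabloid m n k))) /= [X in (_ = _ + X)%R]big1 ?addr0.
    apply: eq_bigl => B; rewrite !inE; case: (tabloidal B) => //=.
    by case: (G \subset B); rewrite ?andbF //=; do 2!case: all.
  move=> B; rewrite !inE => /andP[/and3P[tB _ ->]]; rewrite tB /=.
  apply: S_coef_outer_eq0; case/andP: tB => _ /existsP[lam hlam].
  by have [c []] := tab_shape_chain hlam.
rewrite -big_enum /= -[RHS](big_map (@remainder _ _) xpredT).
apply: perm_big; apply: uniq_perm; first exact: enum_uniq.
  rewrite map_inj_in_uniq ?filter_uniq ?uniq_chains // => c c' cc cc' e.
  have hc := chain_maximal cc; have hc' := chain_maximal cc'.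
  move: cc cc'; rewrite !mem_filter !mem_large_chains => /and3P[_ sc _] /and3P[_ sc' _].
  apply: (irr_sorted_eq (@shrinks_trans _ _) (@shrinks_irr _ _)) => // z.
  by rewrite hc hc' e.
move=> B; rewrite mem_enum inE; apply/and3P/mapP => [[tB GB hB]|[c cc ->]].
  have /andP[nB /existsP[lam hlam]] := tB.
  have [c [sc hc eic plam]] := tab_shape_chain hlam.
  have eB : remainder c = B by exact: mem_remainder_maximal.
  exists c; last by [].
  rewrite mem_filter mem_large_chains sc /=; apply/andP; split.
    apply: contraNneq nB => c0; rewrite -eB c0; apply/eqP/setP => e.
    by rewrite !inE.
  apply/allP => z zc; apply/andP; split.
    move: zc; rewrite hc => /and5P[_ _ /rectP rz _ _]; apply/rectP => i j iz jz.
    by have := rz i j iz jz; rewrite !inE; apply: contra; exact: (subsetP GB).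
  rewrite -corner_of_semiperimeter; apply: (allP hB); rewrite eic; exact: map_f.
have [eic plam tc] := tab_shape_remainder cc.
move: cc; rewrite mem_filter mem_large_chains => /and3P[_ _ /allP gc]; split=> //.
  apply/subsetP => -[i j] ijG; rewrite inE; apply/hasPn => z /gc /andP[/rectP rz _].
  by apply/negP => /andP[/= iz jz]; have := rz i j iz jz; rewrite inE ijG.
rewrite eic all_map; apply/allP => z /gc /andP[_] /=.
by rewrite -corner_of_semiperimeter.
Qed.

(** The empty chain accounts for the difference between the two sides of
    [sum_chains]: it contributes 1 to the sum over all chains and corresponds to
    the full edge set, which is not tabloidal. *)
Lemma sum_S_coef :
  (\sum_(B in Tabloid m n k | G \subset B) S_coef R k B =
   (~~ [exists M : {set edge m n}, is_assignment k M && (M \subset G)])%:R)%R.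
Proof.
have [k1 km kn] := k_bounds.
rewrite sum_tabloid_chains.
have -> : [exists M : {set edge m n}, is_assignment k M && (M \subset G)] =
    ~~ has_large (~: G) N (set0, setT).
  have := @matching_has_large _ _ G k; rewrite !card_ord => /(_ km) <-.
  apply: eq_existsb => M; rewrite /is_assignment -/(matching M).
  by rewrite -andbA andbCA.
rewrite negbK.
have ltm : #|'I_m| < N by rewrite card_ord; lia.
have ltn : #|'I_n| < N by rewrite card_ord; lia.
have ltf : #|'I_m| < m.+1 by rewrite card_ord.
have := sum_chains (~: G) R ltm ltn ltf.
rewrite (bigD1_seq [::]) ?uniq_chains ?mem_chains //= expr0 mul1r.
move=> /addrI e.
rewrite (eq_big_seq (fun c => - ((-1) ^+ size c * chain_coef N R 0 c)))%R.
  by rewrite big_filter sumrN e opprK.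
move=> c cc; have [eic _ _] := tab_shape_remainder cc.
apply: S_coef_chain eic _; move: cc; rewrite mem_filter mem_large_chains.
by case/and3P => _ _; apply: sub_all => z /andP[].
Qed.

End Chains.
End TabloidIdentity.

(** * The expected time as an integral of tail probabilities *)

From mathcomp Require Import all_classical all_reals all_analysis.
From mathcomp Require Import measurable_realfun.

Import numFieldNormedType.Exports.

Local Open Scope ring_scope.

Section FirstTime.
Local Open Scope ereal_scope.
Variables (R : realType) (Omega : Type) (m n : nat) (t : edge m n -> Omega -> \bar R).
Implicit Types (s : R) (w : Omega).

Definition no_assignment k s w : bool :=
  ~~ [exists M : {set edge m n}, is_assignment k M && (M \subset graph t w s)].

Lemma first_time_ge0 k w : 0 <= first_time t k w.
Proof. by apply: le_ereal_inf_tmp; move=> _ [s [s0 _] <-]; rewrite lee_fin. Qed.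

Lemma lt_first_time k s w : (0 <= s)%R -> (s%:E < first_time t k w) = no_assignment k s w.
Proof.
move=> s0; apply/idP/idP.
  apply: contraTN; rewrite -leNgt => /existsP[M /andP[aM sM]].
  by apply: ereal_inf_lbound; exists s => //; split => //; exists M.
move=> none.
(* The graph does not change until the first edge after s appears. *)
pose u := \big[Order.min/+oo]_(e : edge m n | s%:E < t e w) t e w.
have su : s%:E < u.
  by rewrite /u; elim/big_ind: _ => // [|x y sx sy]; [rewrite ltry | rewrite lt_min sx].
apply: lt_le_trans su _; apply: le_ereal_inf_tmp => _ [s' [s'0 [M [aM sM]]] <-].
rewrite leNgt; apply/negP => s'u; move/negP: none; apply; apply/existsP; exists M.
rewrite aM /=; apply: fintype.subset_trans sM _; apply/fintype.subsetP => e.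
rewrite !inE => ts'; rewrite leNgt; apply/negP => st.
have : u <= t e w by rewrite /u (bigD1 e) //= ge_min lexx.
by rewrite leNgt (le_lt_trans ts' s'u).
Qed.

End FirstTime.

Section Expectation.
Local Open Scope classical_set_scope.
Local Open Scope ereal_scope.
Variable R : realType.
Local Notation mu := (@lebesgue_measure R).

Lemma integral_lincomb d (T : measurableType d) (nu : {measure set T -> \bar R})
    (D : set T) (mD : measurable D) (I : finType) (A : {set I}) (c : I -> R)
    (f : I -> T -> R) : (forall i, i \in A -> nu.-integrable D (EFin \o f i)) ->
  \int[nu]_(x in D) (\sum_(i in A) c i * f i x)%R%:E =
  \sum_(i in A) (c i)%:E * \int[nu]_(x in D) (f i x)%:E.
Proof.
move=> intf.
(* The terms outside A need not be integrable, hence the replacement by 0. *)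
pose g i x := if i \in A then (c i * f i x)%:E else 0.
have intg i : nu.-integrable D (g i).
  rewrite /g; case iA: (i \in A); last exact: integrable0.
  by have := integrableZl mD (c i) (intf i iA); exact.
transitivity (\int[nu]_(x in D) \sum_i g i x).
  by apply: eq_integral => x _; rewrite -sumEFin big_mkcond.
rewrite integral_sum // [RHS]big_mkcond /=; apply: eq_bigr => i _.
rewrite /g; case iA: (i \in A); last by rewrite integral0.
by rewrite -integralZl //; exact: intf.
Qed.

Lemma integral_expRN (r : R) : (0 < r)%R ->
  mu.-integrable `[0%R, +oo[ (fun s => (expR (- (r * s)))%:E) /\
  \int[mu]_(s in `[0%R, +oo[) (expR (- (r * s)))%:E = (r^-1)%:E.
Proof.
move=> r0.
have eqf : {in `[0%R, +oo[%classic, (fun s : R => (exponential_pdf r s)%:E) =1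
    (fun s => r%:E * (expR (- (r * s)))%:E)}.
  by move=> s sD; rewrite /exponential_pdf patchE sD mulNr.
have intp : mu.-integrable `[0%R, +oo[ (fun s => (exponential_pdf r s)%:E).
  by apply: integrableS (integrable_exponential_pdf r0).
have inte : mu.-integrable `[0%R, +oo[ (fun s => (expR (- (r * s)))%:E).
  apply: eq_integrable (integrableZl _ r^-1 intp) => // s sD; rewrite eqf //.
  by rewrite -!EFinM mulrA mulVf ?gt_eqF // mul1r.
split=> //.
have : \int[mu]_(s in `[0%R, +oo[) (r%:E * (expR (- (r * s)))%:E) = 1.
  rewrite -(integral_exponential_pdf r0) integral_mkcond.
  apply: eq_integral => s _; rewrite !patchE /exponential_pdf patchE.
  by case: ifP => // _; rewrite -EFinM mulNr.
rewrite integralZl // => e.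
rewrite -[LHS]mul1e -[1](_ : (r^-1)%:E * r%:E = 1); last first.
  by rewrite -EFinM mulVf // gt_eqF.
by rewrite -muleA e mule1.
Qed.

Variables (d : measure_display) (Omega : measurableType d) (P : probability Omega R).

(** The value X w is the length of the set of s >= 0 below it; exchange the two
    integrals. *)
Lemma ge0_integral_tail (X : Omega -> \bar R) :
    measurable_fun setT X -> (forall w, 0 <= X w) ->
  \int[P]_w X w = \int[mu]_(s in `[0%R, +oo[) P [set w | s%:E < X w].
Proof.
move=> mX X0.
pose GR := measurableTypeR R.
pose D : set R := `[0%R, +oo[.
pose A : set (Omega * GR) := [set p | (0 <= p.2)%R /\ p.2%:E < X p.1].
have mA : measurable A.
  rewrite (_ : A = [set p : Omega * GR | (0 <= p.2)%R] `&`
                   [set p : Omega * GR | p.2%:E < X p.1]) //.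
  apply: measurableI.
    have : measurable_fun setT (fun p : Omega * GR => (0 <= p.2)%R).
      exact: measurable_fun_ler.
    by move=> /(_ measurableT [set true]); rewrite setTI; exact.
  have : measurable_fun setT (fun p : Omega * GR => p.2%:E < X p.1).
    apply: measurable_fun_lte; first exact/measurable_EFinP.
    exact: measurableT_comp mX _.
  by move=> /(_ measurableT [set true]); rewrite setTI; exact.
transitivity (\int[P]_w \int[mu]_s (\1_A (w, s))%:E).
  apply: eq_integral => w _.
  rewrite (_ : (fun s => _) = (fun s => (\1_(xsection A w) s)%:E)); last first.
    by apply/funext => s; rewrite !indicE mem_xsection.
  rewrite integral_indic //; last exact: measurable_xsection.
  rewrite setIT.
  case Xw: (X w) (X0 w) => [x| |] // x0.
    rewrite (_ : xsection A w = `[0%R, x[%classic); last first.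
      apply/seteqP; split => s; rewrite /xsection /= inE /A /= Xw in_itv /= lte_fin.
        by move=> [-> ->].
      by move=> /andP[-> ->].
    rewrite /= lebesgue_measure_itv /= lte_fin; case: ltP => [_|x0'].
      by rewrite sube0.
    rewrite lee_fin in x0; congr EFin; apply/eqP.
    by rewrite eq_le x0 x0'.
  rewrite (_ : xsection A w = `[0%R, +oo[%classic); last first.
    apply/seteqP; split => s; rewrite /xsection /= inE /A /= Xw in_itv /= andbT ltry.
      by case.
    by [].
  by rewrite /= lebesgue_measure_itv /= ltry sube0.
rewrite (fubini_tonelli (m2 := mu) (fun p : Omega * GR => (\1_A p)%:E)) //=; last first.
  exact/measurable_EFinP/measurable_indic.
rewrite [RHS]integral_mkcond; apply: eq_integral => s _; rewrite patchE.
case: ifPn => [|]; rewrite ?inE ?notin_setE /D /= in_itv /= andbT.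
  move=> s0; pose B : set Omega := [set w | (s : R)%:E < X w].
  have mB : measurable B.
    by rewrite -[B]setTI; exact: emeasurable_fun_o_infty.
  transitivity (\int[P]_w (\1_B w)%:E); last by rewrite integral_indic ?setIT.
  apply: eq_integral => w _; rewrite !indicE; congr ((nat_of_bool _)%:R%:E).
  by apply/idP/idP; rewrite !inE /A /=; [case|split].
move=> /negP; rewrite -ltNge => s0; apply: integral0_eq => w _.
rewrite indicE memNset //= => -[]; by rewrite leNgt s0.
Qed.

End Expectation.

Section TailProbability.
Local Open Scope classical_set_scope.
Local Open Scope ereal_scope.
Variables (R : realType) (d : measure_display) (Omega : measurableType d).
Variables (P : probability Omega R) (m n k : nat).
Variables (a : edge m n -> R) (t : edge m n -> {RV P >-> \bar R}).
Local Notation times := (fun e => t e : Omega -> \bar R).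

Lemma measurable_no_assignment (s : R) : measurable [set w | no_assignment times k s w].
Proof.
pose U := \bigcup_(M in [set M : {set edge m n} | is_assignment k M])
  \bigcap_(e in [set` M]) [set w | t e w <= s%:E].
have -> : [set w | no_assignment times k s w] = ~` U.
  apply/seteqP; split => w /=.
    move=> /existsPn h [M /= aM hM]; have /negP := h M; apply; rewrite aM /=.
    by apply/fintype.subsetP => e eM; rewrite inE; exact: hM.
  move=> h; apply/existsPn => M; apply/negP => /andP[aM /fintype.subsetP sM]; apply: h.
  by exists M => // e eM; have := sM e eM; rewrite inE.
apply: measurableC; apply: fin_bigcup_measurable; first exact: finite_finset.
move=> M _; apply: fin_bigcap_measurable; first exact: finite_finset.
move=> e _; rewrite -[X in measurable X]setTI.
by apply: emeasurable_fun_infty_c => //; exact: measurable_funPT.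
Qed.

Lemma measurable_first_time : measurable_fun setT (first_time times k).
Proof.
apply: (measurability _ (ErealGenOInfty.measurableE R)) => // _ [_ [r ->] <-].
rewrite setTI.
have [r0|r0] := leP 0%R r.
  rewrite [X in measurable X](_ : _ = [set w | no_assignment times k r w]).
    exact: measurable_no_assignment.
  by apply/seteqP; split => w /=; rewrite in_itv /= andbT lt_first_time.
rewrite [X in measurable X](_ : _ = setT) //.
apply/seteqP; split => w //= _; rewrite in_itv /= andbT.
by rewrite (lt_le_trans _ (first_time_ge0 _ _ _)).
Qed.

Hypotheses (t_exp : forall e, exponential_time (a e) (t e)).
Hypotheses (t_indep : mutually_independent t).
Hypotheses (k_range : (1 <= k <= minn m n)%N).

Definition graph_within (s : R) (B : {set edge m n}) : set Omega :=
  [set w | graph times w s \subset B].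

Lemma graph_withinE s B : graph_within s B =
  \bigcap_(e in [set` ~: B]) (t e @^-1` [set x | s%:E < x]).
Proof.
apply/seteqP; split => w /= h.
  move=> e /=; rewrite inE => eB; rewrite ltNge; apply: contra eB => le.
  by apply: (fintype.subsetP h); rewrite inE.
apply/fintype.subsetP => e; rewrite inE; apply: contraTT => eB.
by rewrite -ltNge; apply: h; rewrite /= inE.
Qed.

Lemma measurable_gt (s : R) : measurable [set x : \bar R | s%:E < x].
Proof.
rewrite (_ : [set x | _] = `]s%:E, +oo[%classic); first exact: emeasurable_itv.
by apply/seteqP; split => x /=; rewrite in_itv /= andbT.
Qed.

Lemma measurable_graph_within s B : measurable (graph_within s B).
Proof.
rewrite graph_withinE; apply: fin_bigcap_measurable; first exact: finite_finset.
move=> e _; rewrite -[X in measurable X]setTI.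
by apply: measurable_funPT => //; exact: measurable_gt.
Qed.

Lemma prob_graph_within s B : (0 <= s)%R ->
  P (graph_within s B) = (expR (- (rate a (~: B) * s)))%:E.
Proof.
move=> s0; rewrite graph_withinE.
rewrite (t_indep (finset.setC B) (fun=> measurable_gt s)).
rewrite (eq_bigr (fun e => (expR (- (a e * s)))%:E)) => [|e _]; last exact: t_exp.
rewrite prodEFin; congr EFin; rewrite /rate mulr_suml -sumrN.
by rewrite expR_sum.
Qed.

Lemma prob_no_assignment s : (0 <= s)%R ->
  P [set w | no_assignment times k s w] =
  (\sum_(B in Tabloid m n k) S_coef R k B * expR (- (rate a (~: B) * s)))%:E.
Proof.
move=> s0; have mN := measurable_no_assignment s.
transitivity (\int[P]_w (\sum_(B in Tabloid m n k)
    S_coef R k B * \1_(graph_within s B) w)%:E).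
  rewrite -[X in P X]setIT -integral_indic //; apply: eq_integral => w _; congr EFin.
  rewrite indicE (_ : (w \in _) = no_assignment times k s w); last first.
    by apply/idP/idP; rewrite inE.
  rewrite -sum_S_coef // big_mkcondr /=; apply: eq_bigr => B _.
  rewrite indicE (_ : (w \in _) = (graph times w s \subset B)); last first.
    by apply/idP/idP; rewrite inE.
  by case: ifP; rewrite ?mulr1 ?mulr0.
rewrite integral_lincomb //=; last first.
  by move=> B _; apply: integrable_indic => //; exact: measurable_graph_within.
rewrite -sumEFin; apply: eq_bigr => B _.
rewrite integral_indic //; last exact: measurable_graph_within.
by rewrite setIT /= prob_graph_within.
Qed.

End TailProbability.
Unset Implicit Arguments.
Local Open Scope ring_scope.

Theorem theorem1p4 (R : realType) (d : measure_display)
    (Omega : measurableType d) (P : probability Omega R)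
    (m n k : nat) (a : edge m n -> R) (t : edge m n -> {RV P >-> \bar R})
    (m_ge1 : (1 <= m)%N) (n_ge1 : (1 <= n)%N) (k_range : (1 <= k <= minn m n)%N)
    (a_ge0 : forall e, 0 <= a e)
    (t_exp : forall e, exponential_time (a e) (t e))
    (t_indep : mutually_independent t)
    (a_tab : forall B, B \in Tabloid m n k -> 0 < rate a (~: B)) :
  (\int[P]_w first_time (fun e => t e : Omega -> \bar R) k w)%E =
  (\sum_(B in Tabloid m n k) S_coef R k B / rate a (~: B))%:E.
Proof.
rewrite ge0_integral_tail; [|exact: measurable_first_time|exact: first_time_ge0].
transitivity (\int[lebesgue_measure]_(s in `[0%R, +oo[%classic)
    (\sum_(B in Tabloid m n k) S_coef R k B * expR (- (rate a (~: B) * s)))%:E)%E.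
  apply: eq_integral => s; rewrite inE /= in_itv /= andbT => s0.
  rewrite -(prob_no_assignment t_exp t_indep k_range s0); congr (P _).
  by apply/seteqP; split => w /=; rewrite lt_first_time.
rewrite integral_lincomb //; last first.
  by move=> B /a_tab /integral_expRN[].
rewrite -sumEFin; apply: eq_bigr => B /a_tab /integral_expRN[_ ->].
by rewrite -EFinM.
Qed.
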